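(* Let $\mu\in\mathbb{R}$, $\sigma>0$ and $0<\alpha<1$. For every integer $n\ge 2$ let $$L_n=2\sqrt{2}\,\sigma\, t_{n-1;\,\alpha/2}\,E_n,\qquad E_n=\frac{\Gamma(n/2)}{\Gamma((n-1)/2)\sqrt{n(n-1)}},$$ be the average length of the standard Student confidence interval of level $1-\alpha$ for $\mu$ based on a sample of size $n$ from $N(\mu,\sigma^2)$. Then $L_{n+1}<L_n$ for every integer $n\ge 2$.
   Context: $t_{d;\,\alpha}$ denotes the quantile of order $1-\alpha$ of the Student distribution with $d$ degrees of freedom (the point at which its distribution function equals $1-\alpha$). If $X_1,\ldots,X_n$ are i.i.d. $N(\mu,\sigma^2)$ with both parameters unknown, $\overline{X}_n$ is the sample mean and $S_n^2=\frac{1}{n-1}\sum_{i=1}^n (X_i-\overline{X}_n)^2$ is the sample variance, the standard Student confidence interval of level $1-\alpha$ for $\mu$ is $\left(\overline{X}_{n}-t_{n-1;\,\alpha/2}\frac{S_{n}}{\sqrt{n}},\ \overline{X}_{n}+t_{n-1;\,\alpha/2}\frac{S_{n}}{\sqrt{n}}\right)$. Its average (expected) length is $L_n$. *)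

(* Defs.v *)
From HB Require Import structures.
From mathcomp Require Import all_boot all_order all_algebra.
From mathcomp Require Import all_classical all_reals all_analysis.
Import Order.TTheory GRing.Theory Num.Theory.
Import numFieldNormedType.Exports.

Set Implicit Arguments.
Unset Strict Implicit.
Unset Printing Implicit Defensive.

Local Open Scope classical_set_scope.
Local Open Scope ring_scope.

(* Real-valued Lebesgue integral; it is finite, hence meaningful, for 0 < a. *)
Definition Gamma (R : realType) (a : R) : R :=
  \int[lebesgue_measure]_(x in `]0, +oo[) (x `^ (a - 1) * expR (- x)).

Definition student_pdf (R : realType) (d : nat) (x : R) : R :=
  Gamma (d.+1%:R / 2) / (Num.sqrt (d%:R * pi) * Gamma (d%:R / 2))
  * (1 + x ^+ 2 / d%:R) `^ (- (d.+1%:R / 2)).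

Definition student_prob (R : realType) (d : nat) (A : set R) : \bar R :=
  (\int[lebesgue_measure]_(x in A) (student_pdf d x)%:E)%E.

Definition student_cdf (R : realType) (d : nat) (x : R) : \bar R :=
  student_prob d `]-oo, x].

(* [get] picks an element of the set, which is a singleton for 0 < d and
   0 < a < 1: the quantile of order 1 - a (a is the upper tail mass). *)
Definition student_quantile (R : realType) (d : nat) (a : R) : R :=
  get [set x : R | student_cdf d x = (1 - a)%:E].

Definition sample_mean (R : realType) (n : nat) (x : 'I_n -> R) : R :=
  (\sum_(i < n) x i) / n%:R.

Definition sample_variance (R : realType) (n : nat) (x : 'I_n -> R) : R :=
  (\sum_(i < n) (x i - sample_mean x) ^+ 2) / n.-1%:R.

Definition student_ci_radius (R : realType) (alpha : R) (n : nat)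
    (x : 'I_n -> R) : R :=
  student_quantile n.-1 (alpha / 2) *
  (Num.sqrt (sample_variance x) / Num.sqrt n%:R).

Definition student_ci_lower (R : realType) (alpha : R) (n : nat)
    (x : 'I_n -> R) : R :=
  sample_mean x - student_ci_radius alpha x.

Definition student_ci_upper (R : realType) (alpha : R) (n : nat)
    (x : 'I_n -> R) : R :=
  sample_mean x + student_ci_radius alpha x.

Definition student_ci_length (R : realType) (alpha : R) (n : nat)
    (x : 'I_n -> R) : R :=
  student_ci_upper alpha x - student_ci_lower alpha x.

Definition mutually_independent (R : realType) (d : measure_display)
    (T : measurableType d) (P : probability T R) (n : nat)
    (X : 'I_n -> {RV P >-> R}) : Prop :=
  forall (J : {set 'I_n}) (A : 'I_n -> set R),
    (forall i, measurable (A i)) ->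
    P (\bigcap_(i in [set` J]) (X i @^-1` A i)) =
    (\prod_(i in J) P (X i @^-1` A i))%E.

(* [normal_prob] takes the standard deviation as its second parameter. *)
Definition iid_normal (R : realType) (mu sigma : R) (d : measure_display)
    (T : measurableType d) (P : probability T R) (n : nat)
    (X : 'I_n -> {RV P >-> R}) : Prop :=
  mutually_independent X /\
  forall (i : 'I_n) (A : set R), measurable A ->
    distribution P (X i) A = normal_prob mu sigma A.

Definition student_E (R : realType) (n : nat) : R :=
  Gamma (n%:R / 2) / (Gamma (n.-1%:R / 2) * Num.sqrt (n%:R * n.-1%:R)).

Definition student_L (R : realType) (sigma alpha : R) (n : nat) : R :=
  2 * Num.sqrt 2 * sigma * student_quantile n.-1 (alpha / 2) * student_E R n.

(* Main.v *)
Require Import Defs.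
From HB Require Import structures.
From mathcomp Require Import all_boot all_order all_algebra.
From mathcomp Require Import all_classical all_reals all_analysis.
From mathcomp Require Import measurable_realfun ring lra.
Import Order.TTheory GRing.Theory Num.Theory.
Import numFieldNormedType.Exports.

Set Implicit Arguments.
Unset Strict Implicit.
Unset Printing Implicit Defensive.

Local Open Scope classical_set_scope.
Local Open Scope ring_scope.

(** The two claims are independent of each other.

    Expected length. Let Q be the sum of squared deviations from the sample mean.
    The length is 2 t sqrt (Q / (n (n - 1))) with t the Student quantile, so the
    first claim is the value of the expectation of sqrt Q. The Laplace transform
    of Q is found without a change of variables in dimension n: integrating
    exp (- s (x_1 - y)^2 - ... - s (x_n - y)^2) over an auxiliary y gives
    exp (- s Q) up to a constant, and for fixed y the integrand is a product, so
    that independence applies ([laplace_sum_sq_dev]). Next, sqrt q is a constant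
    times the integral over u > 0 of (1 - exp (- u^2 q)) / u^2, so the
    expectation of sqrt Q depends only on the Laplace transform
    ([half_moment_laplace]). It can therefore be computed on the Gamma
    distribution, which has the same transform up to scale
    ([expectation_sqrt_sum_sq_dev]).

    Monotonicity. Up to a constant, the length is the quantile of the Student
    variable with n - 1 degrees of freedom multiplied by [student_E]. After this
    rescaling the Gamma factors disappear from the ratio of consecutive densities:
    at 0 the density for n + 1 exceeds the density for n by the factor
    sqrt ((n + 1) / n). On the positive half-line the larger density at 0
    stays the larger one up to a single crossing point
    ([student_profile_crossing], a convexity argument), and both densities have
    mass 1/2 there. Hence the rescaled distribution function for n + 1 is
    strictly larger on the positive half-line ([student_rescaled_cdf_lt]) and its
    quantile strictly smaller.

    The mass 1/2 comes from one double integral ([gamma_student_beta]), which also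
    shows by induction that Gamma is finite at half-integers. *)

(** * Integration on measure spaces and on the line *)

(** Restricted domains reduce to the whole spaces by cutting the integrand off
    outside the rectangle. *)
Lemma tonelli_on (d1 d2 : measure_display) (T1 : measurableType d1)
    (T2 : measurableType d2) (R : realType)
    (m1 : {sigma_finite_measure set T1 -> \bar R})
    (m2 : {sigma_finite_measure set T2 -> \bar R})
    (D1 : set T1) (D2 : set T2) (f : T1 * T2 -> \bar R) :
  measurable D1 -> measurable D2 -> measurable_fun setT f ->
  (forall x y, D1 x -> D2 y -> 0 <= f (x, y))%E ->
  (\int[m1]_(x in D1) \int[m2]_(y in D2) f (x, y) =
   \int[m2]_(y in D2) \int[m1]_(x in D1) f (x, y))%E.
Proof.
move=> mD1 mD2 mf f0.
have mD : measurable (D1 `*` D2) by exact: measurableX.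
pose g : T1 * T2 -> \bar R := f \_ (D1 `*` D2).
have mg : measurable_fun [set: T1 * T2] g.
  apply/(measurable_restrict _ mD) => //.
  exact: measurable_funS mf.
have g0 z : (0 <= g z)%E.
  rewrite /g patchE; case: ifPn => // /[!inE] -[/= z1 z2].
  by case: z z1 z2 => ? ? /=; exact: f0.
have E1 : (\int[m1]_(x in D1) \int[m2]_(y in D2) f (x, y) =
    \int[m1]_x \int[m2]_y g (x, y))%E.
  rewrite integral_mkcond; apply: eq_integral => x _; rewrite patchE.
  case: ifPn => [/set_mem xD|/negP xD].
    rewrite integral_mkcond; apply: eq_integral => y _; rewrite /g !patchE.
    by congr (if _ then _ else _); apply/idP/idP => /[!inE] // -[].
  rewrite integral0_eq// => y _; rewrite /g patchE ifF//.
  by apply/negbTE/negP => /set_mem[/= ? _]; apply: xD; rewrite inE.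
have E2 : (\int[m2]_(y in D2) \int[m1]_(x in D1) f (x, y) =
    \int[m2]_y \int[m1]_x g (x, y))%E.
  rewrite integral_mkcond; apply: eq_integral => y _; rewrite patchE.
  case: ifPn => [/set_mem yD|/negP yD].
    rewrite integral_mkcond; apply: eq_integral => x _; rewrite /g !patchE.
    by congr (if _ then _ else _); apply/idP/idP => /[!inE] // -[].
  rewrite integral0_eq// => x _; rewrite /g patchE ifF//.
  by apply/negbTE/negP => /set_mem[/= _ ?]; apply: yD; rewrite inE.
by rewrite E1 E2 fubini_tonelli.
Qed.

(** A nonnegative function with zero integral vanishes almost everywhere. *)
Lemma integral_pos (d : measure_display) (T : measurableType d) (R : realType)
    (m : {measure set T -> \bar R}) (D : set T) (f : T -> \bar R) :
  measurable D -> measurable_fun D f -> (forall x, D x -> 0 < f x)%E ->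
  (0 < m D)%E -> (0 < \int[m]_(x in D) f x)%E.
Proof.
move=> mD mf f0 mD0; rewrite lt_neqAle integral_ge0 ?andbT; last first.
  by move=> x Dx; rewrite ltW// f0.
apply/eqP => /esym I0; move: mD0; apply/negP; rewrite -leNgt.
have [+ _] := ae_eq_integral_abs m mD mf.
have -> : (\int[m]_(x in D) `|f x| = 0)%E.
  rewrite -[RHS]I0; apply: eq_integral => x /set_mem Dx.
  by rewrite gee0_abs// ltW// f0.
move=> /(_ erefl) ae0; rewrite measure_negligible//.
apply: negligibleS ae0 => x Dx /= /(_ Dx) fx0.
by have := f0 x Dx; rewrite fx0 ltxx.
Qed.

(** Strictness survives because a positive function has a positive integral over
    a set of positive measure. *)
Lemma integral_lt (d : measure_display) (T : measurableType d) (R : realType)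
    (m : {measure set T -> \bar R}) (D : set T) (f g : T -> R) :
  measurable D -> measurable_fun D f -> measurable_fun D g ->
  (forall x, D x -> 0 <= f x) -> (forall x, D x -> f x < g x) -> (0 < m D)%E ->
  (\int[m]_(x in D) (f x)%:E < +oo)%E ->
  (\int[m]_(x in D) (f x)%:E < \int[m]_(x in D) (g x)%:E)%E.
Proof.
move=> mD mf mg f0 fg mD0 foo.
have mgf : measurable_fun D (fun x => (g x - f x)%:E).
  by apply/measurable_EFinP; exact: measurable_funB.
have -> : (\int[m]_(x in D) (g x)%:E =
    \int[m]_(x in D) (f x)%:E + \int[m]_(x in D) (g x - f x)%:E)%E.
  rewrite -ge0_integralD//.
  - by apply: eq_integral => x _; rewrite -EFinD subrKC.
  - exact/measurable_EFinP.
  - by move=> x Dx; rewrite lee_fin subr_ge0 ltW// fg.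
rewrite lteDl.
  by apply: integral_pos => // x Dx; rewrite lte_fin subr_gt0 fg.
by rewrite ge0_fin_numE// integral_ge0.
Qed.

(** The image of Lebesgue measure under multiplication by c, multiplied by c,
    agrees with Lebesgue measure on intervals, hence everywhere. *)
Lemma ge0_integral_scale (R : realType) (c : R) (D : set R) (f : R -> \bar R) :
  0 < c -> measurable D -> measurable_fun D f ->
  (forall x : R, D x -> 0 <= f x)%E ->
  (\int[lebesgue_measure]_(x in D) f x =
   c%:E * \int[lebesgue_measure]_(x in *%R c @^-1` D) f (c * x)%R)%E.
Proof.
move=> c0 mD mf f0.
pose ph := ( *%R c : measurableTypeR R -> measurableTypeR R).
have mph : measurable_fun setT ph.
  exact: (@measurable_funM _ (measurableTypeR R)).
pose image_measure : {measure set (measurableTypeR R) -> \bar R} :=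
  mscale (NngNum (ltW c0)) (pushforward (@lebesgue_measure R) ph).
pose m := image_measure mph.
have Em A : measurable A -> (@lebesgue_measure R) A = m A.
  apply: lebesgue_measure_unique => _ [[a b]] _ <-.
  have E : ph @^-1` `]a, b] = `]a / c, b / c]%classic.
    apply/seteqP; split=> x /=; rewrite !in_itv/= ltr_pdivrMr// ler_pdivlMr//.
      by rewrite !(mulrC x).
    by rewrite !(mulrC x).
  rewrite [RHS](_ : _ = c%:E * lebesgue_measure (ph @^-1` `]a, b]))%E// E.
  rewrite !lebesgue_measure_itv/= !lte_fin ltr_pM2r ?invr_gt0//.
  case: ifPn => _; last by rewrite mule0.
  by rewrite -!EFinD -EFinM; congr EFin; field; rewrite gt_eqF.
rewrite (@eq_measure_integral _ _ _ _ m)//; last by move=> A mA _; exact: Em.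
rewrite ge0_integral_mscale//=.
by rewrite ge0_integral_pushforward// => y /[!inE]; exact: f0.
Qed.

Lemma ge0_integral_scale0y (R : realType) (c : R) (f : R -> \bar R) :
  0 < c -> measurable_fun (`]0, +oo[ : set R) f ->
  (forall x : R, (0 < x)%R -> 0 <= f x)%E ->
  (\int[lebesgue_measure]_(x in `]0%R, +oo[) f x =
   c%:E * \int[lebesgue_measure]_(x in `]0%R, +oo[) f (c * x)%R)%E.
Proof.
move=> c0 mf f0; rewrite (ge0_integral_scale c0)//; last first.
  by move=> x /=; rewrite in_itv/= andbT; exact: f0.
congr (_ * (integral _ _ _))%E; apply/seteqP; split=> x /=;
  by rewrite !in_itv/= !andbT pmulr_rgt0.
Qed.

(** This is the normalization of the normal density of variance 1 / (2 a). *)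
Lemma integral_gaussian (R : realType) (a b : R) : 0 < a ->
  (\int[lebesgue_measure]_x (expR (- (a * (x - b) ^+ 2)))%:E =
   (Num.sqrt (pi / a))%:E)%E.
Proof.
move=> a0; pose s := Num.sqrt (2 * a)^-1.
have s2 : s ^+ 2 = (2 * a)^-1.
  by rewrite sqr_sqrtr// invr_ge0 mulr_ge0// ltW.
have s0 : s != 0 by rewrite gt_eqF// sqrtr_gt0 invr_gt0 mulr_gt0.
have pk : normal_peak s = (Num.sqrt (pi / a))^-1.
  rewrite /normal_peak s2; congr (Num.sqrt _)^-1.
  by rewrite -mulr_natl; field; rewrite gt_eqF.
have pk0 : 0 < Num.sqrt (pi / a) by rewrite sqrtr_gt0 divr_gt0// pi_gt0.
transitivity (\int[lebesgue_measure]_x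
   ((Num.sqrt (pi / a))%:E * (normal_pdf b s x)%:E))%E.
  apply: eq_integral => x _; rewrite -EFinM /normal_pdf (negbTE s0) /= pk.
  rewrite mulVKf ?gt_eqF//.
  rewrite /normal_fun s2; congr (expR _)%:E.
  by rewrite -mulr_natl; field; rewrite gt_eqF.
rewrite ge0_integralZl ?integral_normal_pdf ?mule1//.
- by apply/measurable_EFinP; exact: measurable_normal_pdf.
- by move=> x _; rewrite lee_fin normal_pdf_ge0.
Qed.

Lemma measurable_gaussian (R : realType) (a b : R) :
  measurable_fun setT (fun x : R => expR (- (a * (x - b) ^+ 2))).
Proof.
apply: measurableT_comp => //; apply: measurable_funN.
by apply: measurable_funM => //; apply: measurable_funX; exact: measurable_funB.
Qed.

(** * Laws, densities and independence *)

(** Write f as the integral over t > 0 of the indicator of f > t, and exchange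
    the integrals. It reduces integrals of functions to measures of events. *)
Lemma layer_cake (d : measure_display) (T : measurableType d) (R : realType)
    (m : {sigma_finite_measure set T -> \bar R}) (H : T -> \bar R) (f : T -> R) :
  measurable_fun setT H -> (forall w, 0 <= H w)%E ->
  measurable_fun setT f -> (forall w, 0 <= f w) ->
  (\int[m]_w (H w * (f w)%:E) = \int[lebesgue_measure]_(t in `]0%R, +oo[)
     \int[m]_w (H w * (\1_(`]t, +oo[%classic : set R) (f w))%:E))%E.
Proof.
move=> mH H0 mf f0.
have fE w : (f w)%:E = (\int[lebesgue_measure]_(t in `]0%R, +oo[)
     (\1_(`]t, +oo[%classic : set R) (f w))%:E)%E.
  transitivity (\int[lebesgue_measure]_(t in `]0%R, +oo[)
     (\1_(`]-oo, f w[%classic : set R) t)%:E)%E.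
    rewrite integral_indic// (_ : _ `&` _ = `]0, f w[%classic).
      rewrite /= lebesgue_measure_itv/= lte_fin; case: ltP => [_|f0'].
        by rewrite oppr0 adde0.
      by congr EFin; apply/eqP; rewrite eq_le f0 f0'.
    apply/seteqP; split=> t /=; rewrite !in_itv/= ?andbT; first by move=> [-> ->].
    by move=> /andP[].
  apply: eq_integral => t _; congr EFin; rewrite !indicE; congr ((_ : bool)%:R).
  by apply/idP/idP; rewrite !inE/= !in_itv/= andbT.
pose k (z : T * R) : \bar R := if z.2 < f z.1 then H z.1 else 0%E.
have mk : measurable_fun [set: T * R] k.
  apply: measurable_fun_ifT => //.
  - apply: measurable_fun_ltr => //.
    by apply: (measurableT_comp mf); exact: measurable_fst.
  - by apply: (measurableT_comp mH); exact: measurable_fst.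
have kE w t : (H w * (\1_(`]t, +oo[%classic : set R) (f w))%:E = k (w, t))%E.
  rewrite indicE mem_setE in_itv/= andbT /k/=.
  by case: ifPn => _; rewrite ?mule1 ?mule0.
transitivity (\int[m]_w \int[lebesgue_measure]_(t in `]0%R, +oo[) k (w, t))%E.
  apply: eq_integral => w _; rewrite fE -ge0_integralZl//.
    by apply: eq_integral => t _; rewrite kE.
  apply/measurable_EFinP.
  rewrite (_ : (fun _ => _) = (\1_(`]-oo, f w[%classic : set R) : R -> R)).
    exact: measurable_indic.
  apply/funext => t; rewrite !indicE; congr ((_ : bool)%:R).
  by apply/idP/idP; rewrite !inE/= !in_itv/= andbT.
rewrite (@tonelli_on _ _ _ _ _ m lebesgue_measure setT `]0%R, +oo[%classic k)//.
  by apply: eq_integral => t _; apply: eq_integral => w _; rewrite kE.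
by move=> w t _ _; rewrite /k; case: ifPn.
Qed.

(** By the layer-cake formula, the integral of f only sees the events f > t.
    Used once with a constant weight (independence) and once with a density as
    weight (passing from a law to its density). *)
Lemma weighted_law_eq (d1 d2 : measure_display) (T1 : measurableType d1)
    (T2 : measurableType d2) (R : realType)
    (m1 : {sigma_finite_measure set T1 -> \bar R})
    (m2 : {sigma_finite_measure set T2 -> \bar R})
    (H1 : T1 -> \bar R) (H2 : T2 -> \bar R) (X1 : T1 -> R) (X2 : T2 -> R)
    (f : R -> R) :
  measurable_fun setT H1 -> (forall w, 0 <= H1 w)%E ->
  measurable_fun setT H2 -> (forall w, 0 <= H2 w)%E ->
  measurable_fun setT X1 -> measurable_fun setT X2 ->
  (forall B : set R, measurable B ->
     \int[m1]_w (H1 w * (\1_B (X1 w))%:E) =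
     \int[m2]_w (H2 w * (\1_B (X2 w))%:E))%E ->
  measurable_fun setT f -> (forall x, 0 <= f x) ->
  (\int[m1]_w (H1 w * (f (X1 w))%:E) = \int[m2]_w (H2 w * (f (X2 w))%:E))%E.
Proof.
move=> mH1 H10 mH2 H20 mX1 mX2 E mf f0.
rewrite (layer_cake m1 (f := f \o X1))//; last 2 first.
- exact: (measurableT_comp mf mX1).
- by move=> w; exact: f0.
rewrite (layer_cake m2 (f := f \o X2))//; last 2 first.
- exact: (measurableT_comp mf mX2).
- by move=> w; exact: f0.
apply: eq_integral => t _.
have mB : measurable (f @^-1` `]t, +oo[).
  by rewrite -[X in measurable X]setTI; exact: mf.
exact: (E (f @^-1` `]t, +oo[) mB).
Qed.

(** The product of the indicators is the indicator of the intersection. *)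
Lemma indicator_prod_integral (R : realType) (d : measure_display)
    (T : measurableType d) (P : probability T R) (n : nat)
    (X : 'I_n -> {RV P >-> R}) (B : 'I_n -> set R) :
  mutually_independent X -> (forall i, measurable (B i)) ->
  (\int[P]_w (\prod_(i < n) \1_(B i) (X i w))%:E =
   \prod_(i < n) \int[P]_w (\1_(B i) (X i w))%:E)%E.
Proof.
move=> indep mB.
have mXB i : measurable (X i @^-1` B i) by exact: measurable_funPTI.
(* the defining product rule, taken over the full index set *)
have := indep [set: 'I_n]%SET B mB.
rewrite (_ : \bigcap_(i in _) _ = \bigcap_(i in setT) (X i @^-1` B i)); last first.
  by apply/seteqP; split=> w Hw i _; apply: Hw => //=; rewrite inE.
move=> E; transitivity (\int[P]_w (\1_(\bigcap_(i in setT) (X i @^-1` B i)) w)%:E)%E.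
  apply: eq_integral => w _; congr EFin; rewrite [RHS]indicE.
  have [Hw|Hw] := pselect ((\bigcap_(i in setT) (X i @^-1` B i)) w).
    rewrite [in RHS]mem_set//.
    by rewrite big1// => i _; rewrite indicE mem_set//; apply: Hw.
  rewrite [in RHS]memNset//.
  have [i Hi] : exists i, ~ B i (X i w).
    by apply: contrapT => /forallNP H; apply: Hw => i _; exact: (contrapT (H i)).
  by rewrite (bigD1 i)//= indicE memNset// mul0r.
rewrite integral_indic//; last first.
  by apply: fin_bigcap_measurable.
rewrite setIT; apply: (eq_trans E); apply: eq_big => [i|i _]; first by rewrite inE.
by rewrite (_ : (fun w => _) = (fun w => (\1_(X i @^-1` B i) w)%:E))// integral_indic// setIT.
Qed.

(** Start from indicators and replace them by arbitrary functions one factor at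
    a time: with the other factors fixed, both sides are integrals of the
    remaining factor against weighted laws that agree on events. *)
Lemma independent_integral_prod (R : realType) (d : measure_display)
    (T : measurableType d) (P : probability T R) (n : nat)
    (X : 'I_n -> {RV P >-> R}) (F : 'I_n -> R -> R) :
  mutually_independent X ->
  (forall i, measurable_fun setT (F i)) -> (forall i x, 0 <= F i x) ->
  (\int[P]_w (\prod_(i < n) F i (X i w))%:E =
   \prod_(i < n) \int[P]_w (F i (X i w))%:E)%E.
Proof.
move=> indep mF F0.
have mX i : measurable_fun setT (X i) by exact: measurable_funPT.
(* induction on the number k of factors not yet known to be indicators *)
suff : forall k (F : 'I_n -> R -> R),
    (forall i, measurable_fun setT (F i)) -> (forall i x, 0 <= F i x) ->
    (forall i : 'I_n, (k <= i)%N -> exists2 B, measurable B & F i = \1_B) ->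
  (\int[P]_w (\prod_(i < n) F i (X i w))%:E =
   \prod_(i < n) \int[P]_w (F i (X i w))%:E)%E.
  by move=> /(_ n F mF F0); apply => i; rewrite leqNgt ltn_ord.
elim=> {mF F0}[|k IH] {}F mF F0 FB.
  have /choice[B HB] i : exists B, measurable B /\ F i = \1_B.
    by have [B ? ?] := FB i (leq0n _); exists B.
  under eq_integral do under eq_bigr do rewrite (HB _).2.
  under [RHS]eq_bigr do under eq_integral do rewrite (HB _).2.
  by apply: indicator_prod_integral => // i; exact: (HB i).1.
have [kn|nk] := ltnP k n; last first.
  by apply: IH => // i ki; have := ltn_ord i; rewrite ltnNge (leq_trans nk).
pose j := Ordinal kn.
pose H w := \prod_(i < n | i != j) F i (X i w).
pose C := (\prod_(i < n | i != j) \int[P]_w (F i (X i w))%:E)%E.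
have mH : measurable_fun setT H.
  rewrite /H; under eq_fun do rewrite big_mkcond.
  apply: measurable_prod => i _; case: (i != j) => //.
  exact: (measurableT_comp (mF i) (mX i)).
(* both sides as functions of the j-th factor alone *)
have split (f : R -> R) : (\int[P]_w ((EFin \o H) w * (f (X j w))%:E) =
    \int[P]_w (\prod_(i < n) (if i == j then f else F i) (X i w))%:E)%E.
  apply: eq_integral => w _; rewrite /= -EFinM; congr EFin.
  rewrite (bigD1 j)//= eqxx mulrC; congr (_ * _).
  by apply: eq_bigr => i /negbTE ->.
have Cge0 : (0 <= C)%E.
  by apply: prode_ge0 => i _; apply: integral_ge0 => w _; rewrite lee_fin.
have splitC (f : R -> R) : measurable_fun setT f -> (forall x, 0 <= f x) ->
   (\int[P]_w (cst C w * (f (X j w))%:E) =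
    \prod_(i < n) \int[P]_w ((if i == j then f else F i) (X i w))%:E)%E.
  move=> mf f0; rewrite ge0_integralZl//; last 2 first.
  - by apply/measurable_EFinP; exact: (measurableT_comp mf (mX j)).
  - by move=> w _; rewrite lee_fin.
  rewrite [RHS](bigD1 j)//= eqxx muleC; congr (_ * _)%E.
  by apply: eq_bigr => i /negbTE ->.
have FjE i : (if i == j then F j else F i) = F i by case: eqP => // ->.
transitivity (\int[P]_w ((EFin \o H) w * (F j (X j w))%:E))%E.
  by rewrite split; under [RHS]eq_integral do under eq_bigr do rewrite FjE.
transitivity (\int[P]_w (cst C w * (F j (X j w))%:E))%E; last first.
  by rewrite splitC//; under eq_bigr do rewrite FjE.
apply: weighted_law_eq => //.
- exact/measurable_EFinP.
- by move=> w; rewrite lee_fin prodr_ge0.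
- move=> B mB; rewrite split splitC//; apply: (IH (fun i => if i == j then \1_B else F i)).
  + by move=> i; case: ifP => // _; exact: measurable_indic.
  + by move=> i x; case: ifP => // _.
  + move=> i ki; case: eqP => [_|ij]; first by exists B.
    apply: FB; rewrite ltn_neqAle ki andbT; apply/eqP => kiE.
    by apply: ij; apply: val_inj.
Qed.

Lemma normal_law_integral (R : realType) (mu sigma : R) (d : measure_display)
    (T : measurableType d) (P : probability T R) (X : {RV P >-> R}) (f : R -> R) :
  (forall A : set R, measurable A -> distribution P X A = normal_prob mu sigma A) ->
  measurable_fun setT f -> (forall x, 0 <= f x) ->
  (\int[P]_w (f (X w))%:E =
   \int[lebesgue_measure]_x (normal_pdf mu sigma x * f x)%:E)%E.
Proof.
move=> law mf f0.
have mX : measurable_fun setT X by exact: measurable_funPT.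
transitivity (\int[P]_w (cst 1 w * (f (X w))%:E))%E.
  by apply: eq_integral => w _; rewrite mul1e.
transitivity (\int[lebesgue_measure]_x
    ((normal_pdf mu sigma x)%:E * (f (idfun x))%:E))%E; last by [].
apply: weighted_law_eq => //.
- by apply/measurable_EFinP; exact: measurable_normal_pdf.
- by move=> w; rewrite lee_fin normal_pdf_ge0.
- exact: (@measurable_id _ (measurableTypeR R)).
- move=> B mB; under eq_integral do rewrite mul1e.
  rewrite (_ : (fun w => _) = (fun w => (\1_(X @^-1` B) w)%:E))//.
  rewrite integral_indic//; last exact: measurable_funPTI.
  rewrite setIT; apply: (eq_trans (law B mB)).
  rewrite /normal_prob [LHS]integral_mkcond; apply: eq_integral => x _.
  by rewrite patchE /= indicE; case: ifPn; rewrite ?mule1 ?mule0.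
Qed.

(** * Laplace transform of the sum of squared deviations *)

(** The one-variable Laplace transform of (X - y)^2 for X normal. *)
Lemma integral_normal_gaussian (R : realType) (mu sigma s y : R) :
  0 < sigma -> 0 < s ->
  let v := 1 + 2 * s * sigma ^+ 2 in
  (\int[lebesgue_measure]_x
     (normal_pdf mu sigma x * expR (- (s * (x - y) ^+ 2)))%:E =
   ((Num.sqrt v)^-1 * expR (- (s / v * (y - mu) ^+ 2)))%:E)%E.
Proof.
move=> sigma0 s0 v.
have v0 : 0 < v by rewrite /v addr_gt0// !mulr_gt0// exprn_gt0.
have sig2 : 0 < sigma ^+ 2 by rewrite exprn_gt0.
(* completing the square: the product of the two Gaussians is a Gaussian in x
   with rate A and centre m, times a Gaussian in y *)
pose A := v / (2 * sigma ^+ 2).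
have A0 : 0 < A by rewrite divr_gt0// mulr_gt0.
pose m := (s * y + mu / (2 * sigma ^+ 2)) / A.
pose c := normal_peak sigma * expR (- (s / v * (y - mu) ^+ 2)).
have c0 : 0 <= c by rewrite mulr_ge0 ?normal_peak_ge0 ?expR_ge0.
transitivity (\int[lebesgue_measure]_x (c%:E * (expR (- (A * (x - m) ^+ 2)))%:E))%E.
  apply: eq_integral => x _; rewrite /normal_pdf gt_eqF// -EFinM; congr EFin.
  rewrite /c /normal_fun -!mulrA; congr (_ * _); rewrite -!expRD; congr expR.
  rewrite /m /A /v -mulr_natl; field.
  by rewrite !gt_eqF//= -/v.
rewrite ge0_integralZl//=; last first.
  by apply/measurable_EFinP; exact: measurable_gaussian.
rewrite integral_gaussian// -EFinM /c mulrAC; congr (_ * _)%:E.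
rewrite /normal_peak -sqrtrV ?mulrn_wge0 ?mulr_ge0 ?pi_ge0 ?ltW//.
rewrite -sqrtrM ?invr_ge0 ?mulrn_wge0 ?mulr_ge0 ?pi_ge0 ?ltW//.
rewrite -sqrtrV ?ltW//; congr Num.sqrt.
rewrite /A -mulr_natl; move: (pi_gt0 R); generalize (@pi R) => p p0; field.
by rewrite !gt_eqF.
Qed.

Definition sum_sq_dev (R : realType) (n : nat) (x : 'I_n -> R) : R :=
  \sum_(i < n) (x i - sample_mean x) ^+ 2.

Lemma sum_sq_dev_ge0 (R : realType) (n : nat) (x : 'I_n -> R) :
  0 <= sum_sq_dev x.
Proof. by apply: sumr_ge0 => i _; rewrite sqr_ge0. Qed.

(** The decomposition of the squared distances to y into the part within the
    sample and the distance from y to the mean. *)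
Lemma sum_sq_shift (R : realType) (n : nat) (x : 'I_n -> R) (y : R) :
  (0 < n)%N ->
  \sum_(i < n) (x i - y) ^+ 2 = sum_sq_dev x + n%:R * (y - sample_mean x) ^+ 2.
Proof.
move=> n0; have nE : n%:R * sample_mean x = \sum_(i < n) x i.
  by rewrite /sample_mean mulrC divfK// pnatr_eq0 -lt0n.
rewrite /sum_sq_dev; set m := sample_mean x in nE *.
have E (z : R) : \sum_(i < n) (x i - z) ^+ 2 =
    \sum_(i < n) x i ^+ 2 - 2 * z * (n%:R * m) + n%:R * z ^+ 2.
  rewrite nE mulr_sumr -sumrB.
  have -> : n%:R * z ^+ 2 = \sum_(i < n) z ^+ 2.
    by rewrite sumr_const card_ord mulr_natl.
  by rewrite -big_split/=; apply: eq_bigr => i _; ring.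
by rewrite !E; ring.
Qed.

Lemma measurable_sum_sq_dev (R : realType) (d : measure_display)
    (T : measurableType d) (P : probability T R) (n : nat)
    (X : 'I_n -> {RV P >-> R}) :
  measurable_fun setT (fun w => sum_sq_dev (fun i => X i w)).
Proof.
have mX i : measurable_fun setT (X i) by exact: measurable_funPT.
apply: measurable_sum => i; apply: measurable_funX; apply: measurable_funB => //.
by apply: measurable_funM => //; exact: measurable_sum.
Qed.

(** The sum of squared deviations Q couples the observations through the mean.
    To decouple them, integrate exp (- s (x_1 - y)^2 - ... - s (x_n - y)^2) over
    y: by the decomposition above this is exp (- s Q) up to the constant
    sqrt (pi / (s n)), while for fixed y it is a product over the observations. *)
Lemma laplace_sum_sq_dev (R : realType) (mu sigma s : R) (d : measure_display)
    (T : measurableType d) (P : probability T R) (n : nat)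
    (X : 'I_n.+1 -> {RV P >-> R}) :
  0 < sigma -> 0 < s -> iid_normal mu sigma X ->
  (\int[P]_w (expR (- (s * sum_sq_dev (fun i => X i w))))%:E =
   ((Num.sqrt (1 + 2 * s * sigma ^+ 2))^-1 ^+ n)%:E)%E.
Proof.
move=> sigma0 s0 [indep law]; set v := 1 + 2 * s * sigma ^+ 2.
have v0 : 0 < v by rewrite /v addr_gt0// !mulr_gt0// exprn_gt0.
have mX i : measurable_fun setT (X i) by exact: measurable_funPT.
pose N : R := n.+1%:R; have N0 : 0 < N by rewrite ltr0n.
pose q := Num.sqrt (pi / (s * N)).
have q0 : 0 < q by rewrite sqrtr_gt0 divr_gt0 ?pi_gt0// mulr_gt0.
pose k (z : T * R) := \prod_(i < n.+1) expR (- (s * (X i z.1 - z.2) ^+ 2)).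
have mk : measurable_fun [set: T * R] k.
  apply: measurable_prod => i _; apply: measurableT_comp => //.
  apply: measurable_funN; apply: measurable_funM => //; apply: measurable_funX.
  apply: measurable_funB => //.
  by apply: (measurableT_comp (mX i)); exact: measurable_fst.
have k0 z : 0 <= k z by apply: prodr_ge0 => i _; exact: expR_ge0.
(* for a fixed sample, the integral over y recovers exp (- s Q) *)
have Ew w : (q%:E * (expR (- (s * sum_sq_dev (fun i => X i w))))%:E =
    \int[lebesgue_measure]_y (k (w, y))%:E)%E.
  rewrite muleC -(integral_gaussian (sample_mean (fun i => X i w)) (mulr_gt0 s0 N0)).
  rewrite -ge0_integralZl//=; last first.
    by apply/measurable_EFinP; exact: measurable_gaussian.
  apply: eq_integral => y _; rewrite /k -EFinM -expRD -expR_sum; congr (expR _)%:E.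
  rewrite sumrN -mulr_sumr sum_sq_shift// -/N. rewrite /=; ring.
(* for a fixed y, independence factors the expectation *)
have Ey y : (\int[P]_w (k (w, y))%:E =
    ((Num.sqrt v)^-1 ^+ n.+1)%:E * (expR (- (s / v * N * (y - mu) ^+ 2)))%:E)%E.
  rewrite /k/= (independent_integral_prod (F := fun _ x => expR (- (s * (x - y) ^+ 2)))) //.
  - rewrite (eq_bigr (fun=> ((Num.sqrt v)^-1 * expR (- (s / v * (y - mu) ^+ 2)))%:E)).
      rewrite prodEFin prodr_const card_ord exprMn -EFinM; congr (_ * _)%:E.
      by rewrite -expRM_natl -/N; congr expR; ring.
    move=> i _; rewrite -integral_normal_gaussian//.
    apply: (@normal_law_integral _ _ _ _ _ _ _ (fun x => expR (- (s * (x - y) ^+ 2))) (law i)).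
      exact: measurable_gaussian.
    by move=> x; exact: expR_ge0.
  - by move=> i; exact: measurable_gaussian.
transitivity (q^-1%:E *
   \int[P]_w (q%:E * (expR (- (s * sum_sq_dev (fun i => X i w))))%:E))%E.
  rewrite ge0_integralZl ?lee_fin ?(ltW q0)//; last first.
    apply/measurable_EFinP; apply: measurableT_comp => //; apply: measurable_funN.
    by apply: measurable_funM => //; exact: measurable_sum_sq_dev.
  by rewrite muleA -EFinM mulVf ?gt_eqF// mul1e.
under eq_integral do rewrite Ew.
rewrite (@tonelli_on _ _ _ _ _ P lebesgue_measure setT setT (EFin \o k))//; last 2 first.
- exact/measurable_EFinP.
- by move=> x y _ _; rewrite lee_fin.
under eq_integral do rewrite /= Ey.
rewrite ge0_integralZl//; last first.
  by apply/measurable_EFinP; exact: measurable_gaussian.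
rewrite integral_gaussian ?mulr_gt0 ?invr_gt0// -!EFinM; congr EFin.
have -> : pi / (s / v * N) = v * (pi / (s * N)).
  by generalize (@pi R) => p; field; rewrite !gt_eqF.
have sv0 : 0 < Num.sqrt v by rewrite sqrtr_gt0.
by rewrite sqrtrM ?ltW// -/q exprSr; field; rewrite !gt_eqF.
Qed.

(** * The Gamma function at half-integers *)

Lemma powR_add (R : realType) (x r s : R) :
  0 < x -> x `^ (r + s) = x `^ r * x `^ s.
Proof. by move=> x0; rewrite powRD// (gt_eqF x0) implybT. Qed.

(** Extended-real, so that its equations make sense before its finiteness is
    known. *)
Definition eGamma (R : realType) (a : R) : \bar R :=
  (\int[lebesgue_measure]_(x in `]0%R, +oo[) (x `^ (a - 1) * expR (- x))%:E)%E.

Lemma Gamma_fine (R : realType) (a : R) : Gamma a = fine (eGamma a).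
Proof. by []. Qed.

Lemma measurable_gamma (R : realType) (a c : R) (D : set R) :
  measurable_fun D (fun x : R => x `^ (a - 1) * expR (- (c * x))).
Proof.
apply: measurable_funTS; apply: measurable_funM; first exact: measurable_powR.
by apply: measurableT_comp => //; apply: measurable_funN; exact: measurable_funM.
Qed.

Lemma measurable_gamma1 (R : realType) (a : R) (D : set R) :
  measurable_fun D (fun x : R => x `^ (a - 1) * expR (- x)).
Proof.
rewrite (_ : (fun x => _) = (fun x : R => x `^ (a - 1) * expR (- (1 * x)))).
  exact: measurable_gamma.
by apply/funext => x; rewrite mul1r.
Qed.

Lemma gamma_scale (R : realType) (a c : R) : 0 < c ->
  (\int[lebesgue_measure]_(x in `]0%R, +oo[)
     (x `^ (a - 1) * expR (- (c * x)))%:E = (c `^ (- a))%:E * eGamma a)%E.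
Proof.
move=> c0; rewrite /eGamma.
have mI : measurable_fun (`]0, +oo[ : set R)
    (fun x : R => (x `^ (a - 1) * expR (- x))%:E).
  apply/measurable_EFinP; exact: measurable_gamma1.
rewrite [in RHS](@ge0_integral_scale0y _ c)//; last first.
  by move=> x x0; rewrite lee_fin mulr_ge0 ?powR_ge0 ?expR_ge0.
have -> : (\int[lebesgue_measure]_(x in `]0%R, +oo[)
      ((c * x) `^ (a - 1) * expR (- (c * x)))%:E =
    (c `^ (a - 1))%:E * \int[lebesgue_measure]_(x in `]0%R, +oo[)
      (x `^ (a - 1) * expR (- (c * x)))%:E)%E.
  rewrite -ge0_integralZl//.
  - apply: eq_integral => x /[!inE]/= /[!in_itv]/= /[!andbT] x0.
    by rewrite -EFinM mulrA powRM// ltW.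
  - by apply/measurable_EFinP; exact: measurable_gamma.
  - by move=> x _; rewrite lee_fin mulr_ge0 ?powR_ge0 ?expR_ge0.
  - by rewrite lee_fin powR_ge0.
rewrite !muleA -!EFinM.
rewrite (_ : c `^ (- a) * c * c `^ (a - 1) = 1) ?mul1e//.
rewrite -{2}(powRr1 (ltW c0)) -!powR_add//.
by rewrite (_ : - a + 1 + (a - 1) = 0) ?powRr0//; ring.
Qed.

(** Both sides are the double integral over x > 0 and real u of
    x^(b - 1/2) exp (- x) exp (- x u^2). For half-integers it is at once the
    normalization of the Student density and a recursion for Gamma. *)
Lemma gamma_student_beta (R : realType) (b : R) :
  (eGamma (b + 2^-1)%R *
     \int[lebesgue_measure]_u ((1 + u ^+ 2) `^ (- (b + 2^-1)))%:E =
   (Num.sqrt pi)%:E * eGamma b)%E.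
Proof.
pose k (z : R * R) : R :=
  z.1 `^ (b + 2^-1 - 1) * expR (- z.1) * expR (- (z.1 * z.2 ^+ 2)).
have mk : measurable_fun [set: R * R] k.
  apply: measurable_funM; first apply: measurable_funM.
  - by apply: (measurableT_comp (measurable_powR _)); exact: measurable_fst.
  - by apply: measurableT_comp => //; apply: measurable_funN; exact: measurable_fst.
  - apply: measurableT_comp => //; apply: measurable_funN; apply: measurable_funM.
      exact: measurable_fst.
    by apply: measurable_funX; exact: measurable_snd.
have k0 z : 0 <= k z by rewrite !mulr_ge0 ?powR_ge0 ?expR_ge0.
(* integrating out x first gives the left-hand side, u first the right-hand
   side *)
have Eu u : (\int[lebesgue_measure]_(x in `]0%R, +oo[) (k (x, u))%:E =
    eGamma (b + 2^-1)%R * ((1 + u ^+ 2) `^ (- (b + 2^-1)))%:E)%E.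
  have u1 : 0 < 1 + u ^+ 2 by rewrite ltr_pwDl// sqr_ge0.
  rewrite muleC -(gamma_scale _ u1).
  apply: eq_integral => x _; rewrite /k/= -mulrA -expRD.
  by congr (_ * expR _)%:E; ring.
have Ex x : 0 < x -> (\int[lebesgue_measure]_u (k (x, u))%:E =
    (Num.sqrt pi)%:E * (x `^ (b - 1) * expR (- x))%:E)%E.
  move=> x0; rewrite /k/=; under eq_integral do rewrite EFinM.
  rewrite ge0_integralZl//; last 2 first.
  - apply/measurable_EFinP; apply: measurableT_comp => //; apply: measurable_funN.
    by apply: measurable_funM => //; exact: measurable_funX.
  - by rewrite lee_fin mulr_ge0 ?powR_ge0 ?expR_ge0.
  have -> : (\int[lebesgue_measure]_u (expR (- (x * u ^+ 2)))%:E =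
      (Num.sqrt (pi / x))%:E)%E.
    by rewrite -(integral_gaussian 0 x0); apply: eq_integral => u _; rewrite subr0.
  rewrite -!EFinM; congr EFin.
  rewrite sqrtrM ?pi_ge0// sqrtrV ?ltW// -(powR12_sqrt (ltW x0)) -powRN.
  rewrite (_ : b - 1 = (b + 2^-1 - 1) + - 2^-1); last by field.
  by rewrite [X in _ = _ * (X * _)]powR_add//; ring.
rewrite -ge0_integralZl//; last 3 first.
- apply/measurable_EFinP; apply: (measurableT_comp (measurable_powR _)).
  by apply: measurable_funD => //; exact: measurable_funX.
- by move=> u _; rewrite lee_fin powR_ge0.
- by apply: integral_ge0 => x _; rewrite lee_fin mulr_ge0 ?powR_ge0 ?expR_ge0.
under eq_integral do rewrite -Eu.
rewrite -(@tonelli_on _ _ _ _ _ lebesgue_measure lebesgue_measure _ setT (EFin \o k))//; last 2 first.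
- exact/measurable_EFinP.
- by move=> x y _ _; rewrite lee_fin.
rewrite /eGamma -ge0_integralZl//; last 2 first.
- by apply/measurable_EFinP; exact: measurable_gamma1.
- by move=> u _; rewrite lee_fin mulr_ge0 ?powR_ge0 ?expR_ge0.
by apply: eq_integral => x /[!inE]/= /[!in_itv]/= /[!andbT] x0; exact: Ex.
Qed.

Lemma eGamma_gt0 (R : realType) (a : R) : (0 < eGamma a)%E.
Proof.
apply: integral_pos => //.
- by apply/measurable_EFinP; exact: measurable_gamma1.
- move=> x /=; rewrite in_itv/= andbT => x0.
  by rewrite lte_fin mulr_gt0 ?powR_gt0 ?expR_gt0.
- by rewrite /= lebesgue_measure_itv/= ltry addye.
Qed.

Lemma eGamma1 (R : realType) : eGamma (1 : R) = 1%E.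
Proof.
rewrite -[RHS](@integral_exponential_pdf R 1 ltr01).
rewrite [RHS](_ : _ = \int[lebesgue_measure]_(x in `[0%R, +oo[) (expR (- x))%:E)%E.
  rewrite -integral_itv_obnd_cbnd; last first.
    by apply/measurable_EFinP; apply: measurableT_comp.
  apply: eq_integral => x /[!inE]/= /[!in_itv]/= /[!andbT] x0.
  by rewrite subrr powRr0 mul1r.
rewrite [RHS]integral_mkcond; apply: eq_integral => x _.
by rewrite /exponential_pdf !patchE; case: ifPn => // _; rewrite mul1r mulN1r.
Qed.

Lemma integral_cauchy (R : realType) :
  (\int[@lebesgue_measure R]_x ((1 + x ^+ 2)^-1)%:E = pi%:E)%E.
Proof.
rewrite (@ge0_symfun_integralT R (fun x => (1 + x ^+ 2)^-1)); first last.
- by move=> x; rewrite /= sqrrN.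
- exact: continuous_oneDsqrV.
- by move=> x; rewrite invr_ge0 addr_ge0// sqr_ge0.
by rewrite -set_itvcy integral0y_oneDsqr -EFinM; congr EFin; rewrite mulrC divfK.
Qed.

(** Each step is [gamma_student_beta]: the Student integral is positive, so an
    infinite value at the next half-integer would make the previous one
    infinite. *)
Lemma eGamma_half_fin (R : realType) (n : nat) :
  eGamma (n.+1%:R / 2 : R) \is a fin_num.
Proof.
have pi0 := pi_gt0 R.
have spi0 : (0 < (Num.sqrt (@pi R))%:E)%E by rewrite lte_fin sqrtr_gt0.
elim: n => [|n IH].
  (* Gamma 1 = 1 and the Cauchy integral give Gamma (1/2) *)
  have := gamma_student_beta (2^-1 : R).
  rewrite (_ : 2^-1 + 2^-1 = 1 :> R); last by field.
  rewrite eGamma1 mul1e; under eq_integral.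
    move=> u _; rewrite powR_inv1; last by rewrite addr_ge0// sqr_ge0.
    over.
  rewrite integral_cauchy mul1r => E.
  rewrite fin_numElt (lt_trans _ (eGamma_gt0 _))//= ltNge leye_eq.
  by apply/eqP => Ey; move: E; rewrite Ey gt0_muley.
have := gamma_student_beta (n.+1%:R / 2 : R).
rewrite (_ : n.+1%:R / 2 + 2^-1 = n.+2%:R / 2); last by rewrite -(natr1 n.+1); field.
set I := (\int[_]_u _)%E => E.
have I0 : (0 < I)%E.
  apply: integral_pos => //.
  - apply/measurable_EFinP; apply: (measurableT_comp (measurable_powR _)).
    by apply: measurable_funD => //; exact: measurable_funX.
  - by move=> u _; rewrite lte_fin powR_gt0// ltr_pwDl// sqr_ge0.
  - by rewrite -set_itvNyy /= lebesgue_measure_itv/= addye.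
rewrite fin_numElt (lt_trans _ (eGamma_gt0 _))//= ltNge leye_eq.
apply/eqP => Ey; move: E; rewrite Ey gt0_mulye// => E.
by move: IH => /(fin_numM (_ : (Num.sqrt (@pi R))%:E \is a fin_num)%E); rewrite -E => /(_ isT).
Qed.

Lemma Gamma_half_gt0 (R : realType) (n : nat) : 0 < Gamma (n.+1%:R / 2 : R).
Proof. by rewrite Gamma_fine fine_gt0// eGamma_gt0/= -ge0_fin_numE ?eGamma_half_fin ?ltW ?eGamma_gt0. Qed.

Lemma eGamma_half (R : realType) (n : nat) :
  eGamma (n.+1%:R / 2 : R) = (Gamma (n.+1%:R / 2 : R))%:E.
Proof. by rewrite Gamma_fine fineK// eGamma_half_fin. Qed.

(** * Half moments from Laplace transforms *)

(** Its value is sqrt pi; it is a factor on both sides of each comparison of half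
    moments and cancels. *)
Definition half_moment_const (R : realType) : \bar R :=
  (\int[lebesgue_measure]_(u in `]0%R, +oo[) ((1 - expR (- u ^+ 2)) / u ^+ 2)%:E)%E.

Lemma measurable_half_kernel (R : realType) (q : R) (D : set R) :
  measurable_fun D (fun u : R => (1 - expR (- (u ^+ 2 * q))) / u ^+ 2).
Proof.
apply: measurable_funTS; apply: measurable_funM.
  apply: measurable_funB => //; apply: measurableT_comp => //.
  by apply: measurable_funN; apply: measurable_funM => //; exact: measurable_funX.
rewrite (_ : (fun _ => _) = (fun x : R => (x ^+ 2) `^ (-1))).
  by apply: (measurableT_comp (measurable_powR _)); exact: measurable_funX.
by apply/funext => x; rewrite powR_inv1// sqr_ge0.
Qed.

Lemma measurable_half_kernel1 (R : realType) (D : set R) :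
  measurable_fun D (fun u : R => (1 - expR (- u ^+ 2)) / u ^+ 2).
Proof.
rewrite (_ : (fun u => _) = (fun u : R => (1 - expR (- (u ^+ 2 * 1))) / u ^+ 2)).
  exact: measurable_half_kernel.
by apply/funext => u; rewrite mulr1.
Qed.

Lemma half_kernel_ge0 (R : realType) (q u : R) : 0 <= q ->
  0 <= (1 - expR (- (u ^+ 2 * q))) / u ^+ 2.
Proof.
move=> q0; rewrite divr_ge0 ?sqr_ge0// subr_ge0 -expR0 ler_expR.
by rewrite oppr_le0 mulr_ge0// sqr_ge0.
Qed.

Lemma half_moment_const_gt0 (R : realType) : (0 < half_moment_const R)%E.
Proof.
apply: integral_pos => //.
- by apply/measurable_EFinP; exact: measurable_half_kernel1.
- move=> u /=; rewrite in_itv/= andbT => u0.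
  rewrite lte_fin divr_gt0 ?exprn_gt0// subr_gt0 -expR0 ltr_expR.
  by rewrite oppr_lt0 exprn_gt0.
- by rewrite /= lebesgue_measure_itv/= ltry addye.
Qed.

Lemma half_moment_const_fin (R : realType) : half_moment_const R \is a fin_num.
Proof.
rewrite ge0_fin_numE ?ltW ?half_moment_const_gt0//.
apply: (@le_lt_trans _ _ (\int[@lebesgue_measure R]_x (2 * (1 + x ^+ 2)^-1)%:E)%E).
  rewrite /half_moment_const integral_mkcond; apply: ge0_le_integral => //.
  - move=> u _; rewrite patchE; case: ifPn => // _; rewrite lee_fin.
    by have := @half_kernel_ge0 R 1 u ler01; rewrite mulr1.
  - apply/(measurable_restrict _ _) => //; apply/measurable_EFinP.
    exact: measurable_half_kernel1.
  - apply/measurable_EFinP; apply: measurable_funM => //.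
    by apply: continuous_measurable_fun; exact: continuous_oneDsqrV.
  - move=> u _; rewrite patchE.
    have u2 : 0 <= u ^+ 2 by exact: sqr_ge0.
    case: ifPn => [|_]; last by rewrite lee_fin mulr_ge0// invr_ge0 addr_ge0.
    rewrite inE/= in_itv/= andbT => u0; rewrite lee_fin.
    have {}u2 : 0 < u ^+ 2 by rewrite exprn_gt0.
    set v := u ^+ 2 in u2 *.
    rewrite ler_pdivrMr// mulrAC ler_pdivlMr ?addr_gt0//.
    (* 1 - exp (- v) is at most min v 1, which is at most 2 v / (1 + v) *)
    have e1 := expR_ge1Dx (- v); have e0 := expR_ge0 (- v).
    have [v1|v1] := leP v 1; nra.
under eq_integral do rewrite EFinM.
rewrite ge0_integralZl//.
- by rewrite integral_cauchy -EFinM ltry.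
- apply/measurable_EFinP.
  by apply: continuous_measurable_fun; exact: continuous_oneDsqrV.
- by move=> x _; rewrite lee_fin invr_ge0 addr_ge0// sqr_ge0.
Qed.

(** By scaling, the square root is a mixture of the functions
    1 - exp (- s q), up to a constant. *)
Lemma half_kernel_integral (R : realType) (q : R) : 0 <= q ->
  (\int[lebesgue_measure]_(u in `]0%R, +oo[)
     ((1 - expR (- (u ^+ 2 * q))) / u ^+ 2)%:E =
   (Num.sqrt q)%:E * half_moment_const R)%E.
Proof.
rewrite le_eqVlt => /predU1P[<-|q0].
  rewrite sqrtr0 mul0e; apply: integral0_eq => u _.
  by rewrite mulr0 oppr0 expR0 subrr mul0r.
have sq0 : 0 < Num.sqrt q by rewrite sqrtr_gt0.
(* substitute u / sqrt q for u *)
rewrite (ge0_integral_scale0y (c := (Num.sqrt q)^-1)) ?invr_gt0//; last 2 first.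
- by apply/measurable_EFinP; exact: measurable_half_kernel.
- by move=> u _; rewrite lee_fin half_kernel_ge0// ltW.
rewrite /half_moment_const -!ge0_integralZl//.
- apply: eq_integral => u /[!inE]/= /[!in_itv]/= /[!andbT] u0.
  rewrite -!EFinM; congr EFin.
  rewrite exprMn exprVn sqr_sqrtr ?ltW// mulrAC mulVf ?gt_eqF// mul1r.
  rewrite invfM invrK -{2}(sqr_sqrtr (ltW q0)); field.
  by rewrite !gt_eqF.
- by apply/measurable_EFinP; exact: measurable_half_kernel1.
- by move=> u _; rewrite lee_fin; have := half_kernel_ge0 u ler01; rewrite mulr1.
- apply/measurable_EFinP; apply: measurable_funTS.
  have mc : measurable_fun setT ( *%R (Num.sqrt q)^-1 : R -> R).
    exact: (@measurable_funM _ R).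
  exact: (measurableT_comp (@measurable_half_kernel R q setT) mc).
- by move=> u _; rewrite lee_fin half_kernel_ge0// ltW.
Qed.

Lemma half_moment (d : measure_display) (T : measurableType d) (R : realType)
    (m : {sigma_finite_measure set T -> \bar R}) (D : set T) (w Y : T -> R) :
  measurable D -> measurable_fun setT w -> measurable_fun setT Y ->
  (forall x, D x -> 0 <= w x) -> (forall x, D x -> 0 <= Y x) ->
  (\int[m]_(x in D) (Num.sqrt (Y x) * w x)%:E * half_moment_const R =
   \int[lebesgue_measure]_(u in `]0%R, +oo[) \int[m]_(x in D)
     ((1 - expR (- (u ^+ 2 * Y x))) / u ^+ 2 * w x)%:E)%E.
Proof.
move=> mD mw mY w0 Y0.
pose k (z : T * R) : \bar R :=
  ((1 - expR (- (z.2 ^+ 2 * Y z.1))) / z.2 ^+ 2 * w z.1)%:E.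
have mk : measurable_fun [set: T * R] k.
  apply/measurable_EFinP; apply: measurable_funM; last first.
    by apply: (measurableT_comp mw); exact: measurable_fst.
  apply: measurable_funM.
    apply: measurable_funB => //; apply: measurableT_comp => //.
    apply: measurable_funN; apply: measurable_funM; last first.
      by apply: (measurableT_comp mY); exact: measurable_fst.
    by apply: measurable_funX; exact: measurable_snd.
  rewrite (_ : (fun _ => _) = (fun x : T * R => (x.2 ^+ 2) `^ (-1))).
    apply: (measurableT_comp (measurable_powR _)); apply: measurable_funX.
    exact: measurable_snd.
  by apply/funext => x; rewrite powR_inv1// sqr_ge0.
rewrite -(@tonelli_on _ _ _ _ _ m lebesgue_measure D _ k)//; last first.
  by move=> x u Dx _; rewrite lee_fin mulr_ge0 ?half_kernel_ge0 ?w0 ?Y0.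
rewrite muleC -ge0_integralZl//.
- apply: eq_integral => x /set_mem Dx; rewrite /k/=.
  under [RHS]eq_integral do rewrite mulrC EFinM.
  rewrite ge0_integralZl//.
  + by rewrite half_kernel_integral ?Y0// EFinM muleC -muleA muleCA.
  + by apply/measurable_EFinP; exact: measurable_half_kernel.
  + by move=> u _; rewrite lee_fin half_kernel_ge0// Y0.
  + by rewrite lee_fin w0.
- apply/measurable_EFinP; apply: measurable_funTS; apply: measurable_funM => //.
  apply: (measurableT_comp _ mY); apply: continuous_measurable_fun.
  exact: sqrt_continuous.
- by move=> x Dx; rewrite lee_fin mulr_ge0 ?sqrtr_ge0 ?w0.
- by rewrite ltW// half_moment_const_gt0.
Qed.

(** The half moment of Y under the weight w is a functional of its Laplace
    transform: average [half_kernel_integral] over Y. Two nonnegative variables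
    with the same transform thus have the same half moment. *)
Lemma half_moment_laplace (d : measure_display) (T : measurableType d) (R : realType)
    (m : {sigma_finite_measure set T -> \bar R}) (D : set T) (w Y : T -> R)
    (W : R) (phi : R -> R) :
  measurable D -> measurable_fun setT w -> measurable_fun setT Y ->
  (forall x, D x -> 0 <= w x) -> (forall x, D x -> 0 <= Y x) ->
  (\int[m]_(x in D) (w x)%:E = W%:E)%E ->
  (forall s : R, (0 < s)%R ->
    \int[m]_(x in D) (expR (- (s * Y x)) * w x)%:E = (W * phi s)%:E)%E ->
  (\int[m]_(x in D) (Num.sqrt (Y x) * w x)%:E * half_moment_const R =
   \int[lebesgue_measure]_(u in `]0%R, +oo[)
     (W * ((1 - phi (u ^+ 2)) / u ^+ 2))%:E)%E.
Proof.
move=> mD mw mY w0 Y0 EW Ephi; rewrite half_moment//.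
apply: eq_integral => u /[!inE]/= /[!in_itv]/= /[!andbT] u0.
have u2 : 0 < u ^+ 2 by rewrite exprn_gt0.
have me : measurable_fun D (fun x => expR (- (u ^+ 2 * Y x))).
  apply: measurable_funTS; apply: measurableT_comp => //; apply: measurable_funN.
  exact: measurable_funM.
have mwD : measurable_fun D w by exact: measurable_funTS.
have e1 x : D x -> 0 <= 1 - expR (- (u ^+ 2 * Y x)).
  move=> Dx; rewrite subr_ge0 -expR0 ler_expR oppr_le0 mulr_ge0 ?Y0//.
  exact: ltW.
have : (\int[m]_(x in D) ((1 - expR (- (u ^+ 2 * Y x))) * w x)%:E =
    (W * (1 - phi (u ^+ 2)))%:E)%E.
  have : (\int[m]_(x in D) ((1 - expR (- (u ^+ 2 * Y x))) * w x)%:E +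
      (W * phi (u ^+ 2))%:E = W%:E)%E.
    rewrite -Ephi// -EW -ge0_integralD//.
    - by apply: eq_integral => x _; rewrite -EFinD; congr EFin; ring.
    - by move=> x Dx; rewrite lee_fin mulr_ge0 ?e1 ?w0.
    - apply/measurable_EFinP; apply: measurable_funM => //.
      exact: measurable_funB.
    - by move=> x Dx; rewrite lee_fin mulr_ge0 ?expR_ge0 ?w0.
    - by apply/measurable_EFinP; exact: measurable_funM.
  move=> E; rewrite mulrBr mulr1 EFinB -E addeK//.
move=> E.
transitivity ((u ^+ 2)^-1%:E * \int[m]_(x in D) ((1 - expR (- (u ^+ 2 * Y x))) * w x)%:E)%E.
  rewrite -ge0_integralZl//.
  - by apply: eq_integral => x _; rewrite -EFinM; congr EFin; ring.
  - apply/measurable_EFinP; apply: measurable_funM => //.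
    exact: measurable_funB.
  - by move=> x Dx; rewrite lee_fin mulr_ge0 ?e1 ?w0.
  - by rewrite lee_fin invr_ge0 ltW.
by rewrite E -EFinM; congr EFin; ring.
Qed.

(** * The expected length *)

Lemma invr_sqrt_expn (R : realType) (x : R) (n : nat) : 0 <= x ->
  (Num.sqrt x)^-1 ^+ n = x `^ (- (n%:R / 2)).
Proof.
move=> x0; rewrite powRN mulrC powRrM powR12_sqrt// powR_mulrn ?sqrtr_ge0//.
by rewrite exprVn.
Qed.

(** With Q the sum of squared deviations, the Laplace transform of
    Q / (2 sigma^2) is (1 + s)^(- p) with p = (n + 1) / 2, which is also that of the Gamma distribution with shape p;
    the half moment of the latter is Gamma (p + 1/2) / Gamma p. *)
Lemma expectation_sqrt_sum_sq_dev (R : realType) (mu sigma : R)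
    (d : measure_display) (T : measurableType d) (P : probability T R) (n : nat)
    (X : 'I_n.+2 -> {RV P >-> R}) :
  0 < sigma -> iid_normal mu sigma X ->
  (\int[P]_w (Num.sqrt (sum_sq_dev (fun i => X i w)))%:E =
   (sigma * Num.sqrt 2 * (Gamma (n.+2%:R / 2) / Gamma (n.+1%:R / 2)))%:E)%E.
Proof.
move=> sigma0 iidX; pose p : R := n.+1%:R / 2.
pose Q w := sum_sq_dev (fun i => X i w).
have mQ : measurable_fun setT Q by exact: measurable_sum_sq_dev.
have Q0 w : 0 <= Q w by exact: sum_sq_dev_ge0.
(* Q / c has the Gamma distribution with shape p and rate 1 *)
pose c := 2 * sigma ^+ 2; have c0 : 0 < c by rewrite mulr_gt0// exprn_gt0.
pose phi (s : R) := (Num.sqrt (1 + s))^-1 ^+ n.+1.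
have G0 := half_moment_const_gt0 R.
have GF := half_moment_const_fin R.
pose K := (\int[lebesgue_measure]_(u in `]0%R, +oo[)
     ((1 - phi (u ^+ 2)) / u ^+ 2)%:E)%E.
have phi1 u : 0 <= (1 - phi (u ^+ 2)) / u ^+ 2.
  rewrite divr_ge0 ?sqr_ge0// subr_ge0 exprn_ile1 ?invr_ge0 ?sqrtr_ge0//.
  rewrite invf_le1 ?sqrtr_gt0 ?ltr_pwDl ?sqr_ge0//.
  by rewrite -{1}sqrtr1 ler_sqrt ?lerDl ?sqr_ge0// addr_ge0 ?sqr_ge0.
have mphi : measurable_fun (`]0, +oo[ : set R)
    (fun u => ((1 - phi (u ^+ 2)) / u ^+ 2)%:E).
  apply/measurable_EFinP; apply: measurable_funTS.
  rewrite (_ : (fun _ => _) =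
      (fun u : R => (1 - (1 + u ^+ 2) `^ (- p)) * (u ^+ 2) `^ (-1))).
    apply: measurable_funM.
      apply: measurable_funB => //; apply: (measurableT_comp (measurable_powR _)).
      by apply: measurable_funD => //; exact: measurable_funX.
    by apply: (measurableT_comp (measurable_powR _)); exact: measurable_funX.
  apply/funext => u; rewrite powR_inv1 ?sqr_ge0// /phi invr_sqrt_expn//.
  by rewrite addr_ge0 ?sqr_ge0.
(* the half moment of Q / c, from its Laplace transform *)
have EP : (\int[P]_w (Num.sqrt (Q w / c))%:E * half_moment_const R = K)%E.
  transitivity (\int[P]_(w in setT) (Num.sqrt (Q w / c) * cst 1 w)%:E *
      half_moment_const R)%E.
    by congr (_ * _)%E; apply: eq_integral => w _; rewrite mulr1.
  rewrite (@half_moment_laplace _ T R P setT (cst 1) _ 1 phi)//.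
  - by apply: eq_integral => u _; rewrite mul1r.
  - exact: measurable_funM.
  - by move=> w _; rewrite divr_ge0// ltW.
  - transitivity (\int[P]_w cst 1%E w)%E; first by apply: eq_integral.
    by rewrite integral_cst// mul1e; exact: probability_setT.
  - move=> s s0; rewrite mul1r.
    have := laplace_sum_sq_dev sigma0 (divr_gt0 s0 c0) iidX.
    rewrite (_ : 1 + 2 * (s / c) * sigma ^+ 2 = 1 + s); last first.
      by rewrite /c; field; rewrite gt_eqF.
    move=> <-; apply: eq_integral => w _; rewrite mulr1 /Q.
    by congr (expR _)%:E; ring.
(* the same for the unnormalized Gamma density *)
have EG : (eGamma (p + 2^-1)%R * half_moment_const R = (Gamma p)%:E * K)%E.
  transitivity (\int[lebesgue_measure]_(x in `]0%R, +oo[)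
      (Num.sqrt x * (x `^ (p - 1) * expR (- x)))%:E * half_moment_const R)%E.
    congr (_ * _)%E; apply: eq_integral => x /[!inE]/= /[!in_itv]/= /[!andbT] x0.
    rewrite mulrA -(powR12_sqrt (ltW x0)) -powR_add//.
    by congr (_ `^ _ * _)%:E; ring.
  rewrite (@half_moment_laplace _ _ R lebesgue_measure `]0%R, +oo[%classic
     (fun x => x `^ (p - 1) * expR (- x)) id (Gamma p) phi)//.
  - rewrite /K -ge0_integralZl//.
    + by move=> u _; rewrite lee_fin.
    + by rewrite lee_fin ltW// Gamma_half_gt0.
  - exact: measurable_gamma1.
  - by move=> x _; rewrite mulr_ge0 ?powR_ge0 ?expR_ge0.
  - by move=> x /=; rewrite in_itv/= andbT => /ltW.
  - exact: eGamma_half.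
  - move=> s s0; transitivity (\int[lebesgue_measure]_(x in `]0%R, +oo[)
       (x `^ (p - 1) * expR (- ((1 + s) * x)))%:E)%E.
      apply: eq_integral => x _; rewrite mulrCA -expRD.
      by congr (_ * expR _)%:E; ring.
    rewrite gamma_scale ?addr_gt0// eGamma_half -EFinM mulrC /phi.
    by rewrite invr_sqrt_expn// ltW// addr_gt0.
have p2 : p + 2^-1 = n.+2%:R / 2 by rewrite /p -(natr1 n.+1); field.
have Gp : 0 < Gamma p by exact: Gamma_half_gt0.
have EL : (\int[P]_w (Num.sqrt (Q w / c))%:E =
    (Gamma (n.+2%:R / 2) / Gamma p)%:E)%E.
  have Gcancel (x : \bar R) : (x * half_moment_const R / half_moment_const R = x)%E.
    by rewrite -muleA divee ?mule1// gt_eqF.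
  have : (eGamma (p + 2^-1)%R = (Gamma p)%:E * \int[P]_w (Num.sqrt (Q w / c))%:E)%E.
    by rewrite -[LHS]Gcancel EG -EP muleA Gcancel.
  rewrite p2 eGamma_half => E.
  rewrite mulrC EFinM E muleA -EFinM mulVf ?mul1e//.
  by rewrite gt_eqF.
transitivity (\int[P]_w ((Num.sqrt c)%:E * (Num.sqrt (Q w / c))%:E))%E.
  apply: eq_integral => w _; rewrite -EFinM -sqrtrM ?ltW//; congr (Num.sqrt _)%:E.
  by rewrite mulrC divfK ?gt_eqF.
rewrite ge0_integralZl//.
- rewrite EL -EFinM; congr (_ * _)%:E.
  by rewrite /c sqrtrM// sqrtr_sqr gtr0_norm// mulrC.
- apply/measurable_EFinP; apply: (@measurableT_comp _ _ _ _ _ _ (@Num.sqrt R)).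
    by apply: continuous_measurable_fun; exact: sqrt_continuous.
  exact: measurable_funM.
Qed.

Lemma expectation_ci_length (R : realType) (mu sigma alpha : R)
    (d : measure_display) (T : measurableType d) (P : probability T R) (n : nat)
    (X : 'I_n.+2 -> {RV P >-> R}) :
  0 < sigma -> iid_normal mu sigma X ->
  ('E_P[(fun w : T => student_ci_length alpha (fun i => X i w))] =
   (student_L sigma alpha n.+2)%:E)%E.
Proof.
move=> sigma0 iidX; pose t := student_quantile n.+1 (alpha / 2) : R.
pose Q w := sum_sq_dev (fun i => X i w).
have mQ : measurable_fun setT Q by exact: measurable_sum_sq_dev.
have E := expectation_sqrt_sum_sq_dev sigma0 iidX.
pose c := 2 * t / (Num.sqrt n.+1%:R * Num.sqrt n.+2%:R).
rewrite unlock; transitivity (\int[P]_w (c%:E * (Num.sqrt (Q w))%:E))%E.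
  apply: eq_integral => w _; rewrite -EFinM; congr EFin.
  rewrite /student_ci_length /student_ci_upper /student_ci_lower opprB addrC subrKA.
  rewrite /student_ci_radius -/t /sample_variance /= -/(sum_sq_dev _) -/(Q w).
  rewrite sqrtrM ?sum_sq_dev_ge0// sqrtrV// /c; field.
  by rewrite !gt_eqF// sqrtr_gt0.
rewrite integralZl//; last first.
  apply/integrableP; split.
    apply/measurable_EFinP; apply: (@measurableT_comp _ _ _ _ _ _ (@Num.sqrt R)) => //.
    by apply: continuous_measurable_fun; exact: sqrt_continuous.
  by under eq_integral do rewrite gee0_abs ?lee_fin ?sqrtr_ge0//; rewrite E ltry.
rewrite E -EFinM /student_L /student_E -/t; congr EFin.
rewrite /c (sqrtrM _ (ler0n R n.+2)) /=; field.
by rewrite !gt_eqF ?Gamma_half_gt0 ?sqrtr_gt0.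
Qed.

(** * Comparison of densities that cross once *)

Lemma convex_powR_point (R : realType) (k x y t : R) :
  1 <= k -> 0 <= x -> 0 <= y -> 0 <= t <= 1 ->
  (t * x + (1 - t) * y) `^ k <= t * x `^ k + (1 - t) * y `^ k.
Proof.
move=> k1 x0 y0 /andP[t0 t1].
have := @convex_powR R k k1 (Itv01 t0 t1) x y.
by rewrite !inE/= !in_itv/= !andbT => /(_ x0 y0); rewrite !convRE.
Qed.

(** Raised to the power 1 / p, the comparison of the two profiles at s is that of
    the convex function (1 + B s)^(q / p) with the affine function
    c (1 + A s), where c = (L / K)^(1 / p) > 1. The convex function is strictly
    below at 0, hence strictly below before any point where it is not above. *)
Lemma student_profile_crossing (R : realType) (K L A B p q s s' : R) :
  0 < K -> K < L -> 0 <= A -> 0 <= B -> 0 < p -> p <= q -> 0 <= s -> s < s' ->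
  K * (1 + A * s') `^ (- p) <= L * (1 + B * s') `^ (- q) ->
  K * (1 + A * s) `^ (- p) < L * (1 + B * s) `^ (- q).
Proof.
move=> K0 KL A0 B0 p0 pq s0 ss' H.
have L0 : 0 < L by exact: lt_trans KL.
have s'0 : 0 < s' by exact: le_lt_trans ss'.
have pos (C u : R) : 0 <= C -> 0 <= u -> 0 < 1 + C * u.
  by move=> C0 u0; rewrite ltr_pwDl// mulr_ge0.
pose k := q / p.
have k1 : 1 <= k by rewrite /k ler_pdivlMr// mul1r.
pose c := (L / K) `^ p^-1.
have c1 : 1 < c.
  rewrite -[X in X < _](_ : 1 `^ p^-1 = 1); last by rewrite powR1.
  apply: gt0_ltr_powR; rewrite ?invr_gt0// ?nnegrE//.
  - by rewrite divr_ge0// ltW.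
  - by rewrite ltr_pdivlMr// mul1r.
have rootE (a b : R) : 0 < a -> 0 < b ->
    (b `^ k = (b `^ q) `^ p^-1) * (c * a = (L / K * a `^ p) `^ p^-1).
  move=> a0 b0; split; first by rewrite -powRrM.
  rewrite powRM ?powR_ge0 ?divr_ge0 ?(ltW K0) ?(ltW L0)// -powRrM divff ?gt_eqF//.
  by rewrite powRr1// ltW.
have root_homo (x y : R) : 0 <= x -> x <= y -> x `^ p^-1 <= y `^ p^-1.
  move=> x0 xy; apply: ge0_ler_powR; rewrite ?nnegrE ?invr_ge0 ?(ltW p0)//.
  exact: le_trans xy.
have a'0 := pos A s' A0 (ltW s'0); have b'0 := pos B s' B0 (ltW s'0).
have a0 := pos A s A0 s0; have b0 := pos B s B0 s0.
(* at s', the convex side is not above the affine one *)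
have H1 : (1 + B * s') `^ k <= c * (1 + A * s').
  rewrite !(rootE _ _ a'0 b'0); apply: root_homo; first exact: powR_ge0.
  move: H; rewrite !powRN ler_pdivrMr ?powR_gt0// mulrAC ler_pdivlMr ?powR_gt0// => H.
  by rewrite mulrAC ler_pdivlMr// mulrC.
rewrite ltNge; apply/negP => H2.
have {}H2 : c * (1 + A * s) <= (1 + B * s) `^ k.
  rewrite !(rootE _ _ a0 b0); apply: root_homo.
    by rewrite mulr_ge0 ?powR_ge0// divr_ge0// ltW.
  move: H2; rewrite !powRN ler_pdivrMr ?powR_gt0// mulrAC ler_pdivlMr ?powR_gt0// => H2.
  by rewrite mulrAC ler_pdivrMr// [leRHS]mulrC.
(* convexity between 0 and s', at weight s / s' *)
have t01 : 0 <= s / s' <= 1.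
  by rewrite divr_ge0 ?(ltW s'0)//= ler_pdivrMr// mul1r ltW.
have := convex_powR_point k1 (ltW b'0) ler01 t01; rewrite powR1 mulr1.
rewrite (_ : s / s' * _ + _ = 1 + B * s); last by field; rewrite gt_eqF.
have t1 : 0 < 1 - s / s' by rewrite subr_gt0 ltr_pdivrMr// mul1r.
have t0 : 0 <= s / s' by case/andP: t01.
have tA : s / s' * (1 + A * s') + (1 - s / s') = 1 + A * s by field; rewrite gt_eqF.
move=> Hc; have := le_trans H2 Hc; rewrite -tA; apply/negP; rewrite -ltNge.
rewrite [X in _ < X]mulrDr; apply: ler_ltD; last by rewrite ltr_pMl.
by rewrite mulrCA ler_wpM2l.
Qed.

(** If f < g at t then f < g on all of ]0, t]; if not, g < f on all of
    ]t, +oo[, and the total masses are equal. *)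
Lemma single_crossing_integral (R : realType) (f g : R -> R) (M t : R) :
  measurable_fun setT f -> measurable_fun setT g ->
  (forall x, 0 <= f x) -> (forall x, 0 <= g x) ->
  (\int[lebesgue_measure]_(x in `]0%R, +oo[) (f x)%:E = M%:E)%E ->
  (\int[lebesgue_measure]_(x in `]0%R, +oo[) (g x)%:E = M%:E)%E ->
  (forall x y, 0 < x -> x < y -> f y <= g y -> f x < g x) -> 0 < t ->
  (\int[lebesgue_measure]_(x in `]0%R, t]) (f x)%:E <
   \int[lebesgue_measure]_(x in `]0%R, t]) (g x)%:E)%E.
Proof.
move=> mf mg f0 g0 If Ig cross t0.
have split (h : R -> R) : measurable_fun setT h -> (forall x, 0 <= h x) ->
   (\int[lebesgue_measure]_(x in `]0%R, +oo[) (h x)%:E = M%:E)%E ->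
   (\int[lebesgue_measure]_(x in `]0%R, t]) (h x)%:E +
    \int[lebesgue_measure]_(x in `]t, +oo[) (h x)%:E = M%:E)%E.
  move=> mh h0 <-; rewrite -ge0_integral_setU//.
  - congr (integral _ _ _); rewrite -itv_bndbnd_setU//= bnd_simp//.
    exact: ltW.
  - by apply/measurable_EFinP; exact: measurable_funTS.
  - by move=> x _; rewrite lee_fin.
  - apply/disj_setPS => x [] /=; rewrite !in_itv/= andbT => /andP[_ xt].
    by rewrite ltNge xt.
have fin (h : R -> R) (D : set R) : measurable_fun setT h -> (forall x, 0 <= h x) ->
   measurable D -> D `<=` `]0, +oo[%classic ->
   (\int[lebesgue_measure]_(x in `]0%R, +oo[) (h x)%:E = M%:E)%E ->
   (\int[lebesgue_measure]_(x in D) (h x)%:E < +oo)%E.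
  move=> mh h0 mD DS Ih; apply: (@le_lt_trans _ _ M%:E); last exact: ltry.
  rewrite -Ih; apply: ge0_subset_integral => //.
  - by apply/measurable_EFinP; exact: measurable_funTS.
  - by move=> x _; rewrite lee_fin.
have [ft|gt] := ltP (f t) (g t).
  apply: integral_lt => //; try exact: measurable_funTS.
  - move=> x /=; rewrite in_itv/= => /andP[x0]; rewrite le_eqVlt => /predU1P[->//|xt].
    by apply: (cross x t) => //; exact: ltW.
  - by rewrite /= lebesgue_measure_itv/= lte_fin t0 oppr0 adde0.
  - by apply: (fin f _ mf f0 _ _ If) => // x /=; rewrite !in_itv/= andbT => /andP[].
(* otherwise g stays below f beyond t, and the complementary tails compare *)
have tail : (\int[lebesgue_measure]_(x in `]t, +oo[) (g x)%:E <
    \int[lebesgue_measure]_(x in `]t, +oo[) (f x)%:E)%E.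
  apply: integral_lt => //; try exact: measurable_funTS.
  - move=> x /=; rewrite in_itv/= andbT => tx; rewrite ltNge; apply/negP => fg.
    by have := cross t x t0 tx fg; rewrite ltNge gt.
  - by rewrite /= lebesgue_measure_itv/= ltry addye.
  - apply: (fin g _ mg g0 _ _ Ig) => // x /=; rewrite !in_itv/= !andbT; exact: lt_trans.
rewrite ltNge; apply/negP => le.
have := split f mf f0 If; rewrite -(split g mg g0 Ig) => /eqP; apply/negP.
rewrite gt_eqF//; apply: lee_ltD => //.
rewrite ge0_fin_numE; last by apply: integral_ge0 => x _; rewrite lee_fin.
by apply: (fin g _ mg g0 _ _ Ig) => // x /=; rewrite !in_itv/= andbT => /andP[].
Qed.

(** * The Student distribution and its quantiles *)

Lemma student_pdf_gt0 (R : realType) (n : nat) (x : R) : 0 < student_pdf n.+1 x.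
Proof.
rewrite /student_pdf !mulr_gt0 ?powR_gt0 ?invr_gt0 ?mulr_gt0 ?Gamma_half_gt0//.
  by rewrite sqrtr_gt0 mulr_gt0// pi_gt0.
by rewrite ltr_pwDl// divr_ge0// sqr_ge0.
Qed.

Lemma measurable_student_pdf (R : realType) (n : nat) (D : set R) :
  measurable_fun D (@student_pdf R n).
Proof.
apply: measurable_funTS; apply: measurable_funM => //.
apply: (measurableT_comp (measurable_powR _)).
by apply: measurable_funD => //; apply: measurable_funM => //; exact: measurable_funX.
Qed.

Lemma integral_student_pdf (R : realType) (n : nat) :
  (\int[@lebesgue_measure R]_x (student_pdf n.+1 x)%:E = 1)%E.
Proof.
set d : R := n.+1%:R; have d0 : 0 < d by rewrite ltr0n.
have pi0 := pi_gt0 R.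
have sd0 : 0 < Num.sqrt d by rewrite sqrtr_gt0.
have spi0 : 0 < Num.sqrt (@pi R) by rewrite sqrtr_gt0.
rewrite (ge0_integral_scale sd0)//; last 2 first.
- by apply/measurable_EFinP; exact: measurable_student_pdf.
- by move=> x _; rewrite lee_fin ltW// student_pdf_gt0.
have Gd0 := Gamma_half_gt0 R n; have Gd1 := Gamma_half_gt0 R n.+1.
pose K := Gamma (n.+2%:R / 2 : R) / (Num.sqrt (d * pi) * Gamma (n.+1%:R / 2)).
have K0 : 0 <= K by rewrite /K divr_ge0 ?(ltW Gd1)// mulr_ge0 ?sqrtr_ge0 ?(ltW Gd0).
transitivity ((Num.sqrt d)%:E * \int[lebesgue_measure]_x
    (K%:E * ((1 + x ^+ 2) `^ (- (n.+1%:R / 2 + 2^-1)))%:E))%E.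
  apply: (congr1 (mule _)).
  apply: eq_integral => x _.
  rewrite -EFinM /student_pdf -/d -/K exprMn (sqr_sqrtr (ltW d0)).
  rewrite (_ : d * x ^+ 2 / d = x ^+ 2); last by field; rewrite gt_eqF.
  by congr (_ * _ `^ _)%:E; rewrite -(natr1 n.+1); field.
rewrite ge0_integralZl//; last 2 first.
- apply/measurable_EFinP; apply: (measurableT_comp (measurable_powR _)).
  by apply: measurable_funD => //; exact: measurable_funX.
- by move=> x _; rewrite lee_fin powR_ge0.
have := gamma_student_beta (n.+1%:R / 2 : R).
have p2 : n.+1%:R / 2 + 2^-1 = n.+2%:R / 2 :> R by rewrite -(natr1 n.+1); field.
rewrite p2 !eGamma_half => E.
rewrite muleA -EFinM /K (sqrtrM _ (ltW d0)).
move: (Num.sqrt d) (Num.sqrt pi) (Gamma (n.+2%:R / 2)) (Gamma (n.+1%:R / 2)) sd0 spi0 Gd0 Gd1 E.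
move=> sd sp g1 g0 sd0 spi0 Gd0 Gd1 E.
rewrite (_ : _ * (_ / _) = sp^-1 / g0 * g1).
  rewrite EFinM -muleA E muleA -!EFinM; congr EFin.
  by field; rewrite !gt_eqF.
by field; rewrite !gt_eqF.
Qed.

Lemma student_pdfN (R : realType) (n : nat) (x : R) :
  student_pdf n (- x) = student_pdf n x.
Proof. by rewrite /student_pdf sqrrN. Qed.

(** By symmetry of the density. *)
Lemma student_half (R : realType) (n : nat) :
  (\int[@lebesgue_measure R]_(x in `]-oo, 0%R]) (student_pdf n.+1 x)%:E =
   (2^-1)%:E)%E /\
  (\int[@lebesgue_measure R]_(x in `]0%R, +oo[) (student_pdf n.+1 x)%:E =
   (2^-1)%:E)%E.
Proof.
have mf (D : set R) : measurable_fun D (fun x => (student_pdf n.+1 x)%:E).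
  by apply/measurable_EFinP; exact: measurable_student_pdf.
have f0 (x : R) : (0 <= (student_pdf n.+1 x)%:E)%E.
  by rewrite lee_fin ltW// student_pdf_gt0.
have sym : (\int[@lebesgue_measure R]_(x in `]-oo, 0%R]) (student_pdf n.+1 x)%:E =
    \int[@lebesgue_measure R]_(x in `]0%R, +oo[) (student_pdf n.+1 x)%:E)%E.
  rewrite (integral_itv_obnd_cbnd (mf _)).
  rewrite (ge0_integration_by_substitution0 (mf _) f0).
  by apply: eq_integral => x _; rewrite student_pdfN.
have : (\int[@lebesgue_measure R]_(x in `]-oo, 0%R]) (student_pdf n.+1 x)%:E +
    \int[@lebesgue_measure R]_(x in `]0%R, +oo[) (student_pdf n.+1 x)%:E = 1)%E.
  rewrite -(@integral_student_pdf R n) -(itv_setU_setT false (0 : R)).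
  rewrite ge0_integral_setU//; first exact: mf.
  apply/disj_setPS => x [] /=; rewrite !in_itv/= andbT => x0.
  by rewrite ltNge x0.
rewrite sym; set I := (\int[@lebesgue_measure R]_(x in `]0%R, +oo[) _)%E => E.
suff -> : I = (2^-1)%:E by [].
have : (0 <= I)%E by apply: integral_ge0.
move: E; case: I => [r|//|//]; rewrite -EFinD => -[E] _.
by congr EFin; lra.
Qed.

Lemma student_cdf_ge0E (R : realType) (n : nat) (x : R) : 0 <= x ->
  student_cdf n.+1 x =
  ((2^-1)%:E + \int[lebesgue_measure]_(x in `]0%R, x]) (student_pdf n.+1 x)%:E)%E.
Proof.
move=> x0; rewrite -(student_half R n).1 /student_cdf /student_prob.
rewrite -ge0_integral_setU//.
- congr (integral _ _ _); rewrite -itv_bndbnd_setU//= bnd_simp//.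
- by apply/measurable_EFinP; exact: measurable_student_pdf.
- by move=> y _; rewrite lee_fin ltW// student_pdf_gt0.
- apply/disj_setPS => y [] /=; rewrite !in_itv/= => y0.
  by rewrite ltNge y0.
Qed.

Lemma student_cdf_homo (R : realType) (n : nat) (x y : R) : x <= y ->
  (student_cdf n.+1 x <= student_cdf n.+1 y)%E.
Proof.
move=> xy; apply: ge0_subset_integral => //.
- by apply/measurable_EFinP; exact: measurable_student_pdf.
- by move=> z _; rewrite lee_fin ltW// student_pdf_gt0.
- by move=> z /=; rewrite !in_itv/= => /le_trans; apply.
Qed.

Lemma student_cdf0 (R : realType) (n : nat) :
  student_cdf n.+1 (0 : R) = (2^-1)%:E.
Proof. exact: (student_half R n).1. Qed.

(** The set in the definition of the quantile is inhabited, by the intermediate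
    value theorem on the nonnegative half-line. *)
Lemma student_quantile_cdf (R : realType) (n : nat) (a : R) : 0 < a <= 2^-1 ->
  student_cdf n.+1 (student_quantile n.+1 a) = (1 - a)%:E.
Proof.
move=> /andP[a0 a2]; apply: (@getPex _ [set x : R | student_cdf n.+1 x = (1 - a)%:E]).
pose f := @student_pdf R n.+1.
have mf (D : set R) : measurable_fun D (EFin \o f).
  by apply/measurable_EFinP; exact: measurable_student_pdf.
have f0 (x : R) : (0 <= (f x)%:E)%E by rewrite lee_fin ltW// student_pdf_gt0.
have If : (\int[@lebesgue_measure R]_(x in `]0%R, +oo[) (f x)%:E = (2^-1)%:E)%E.
  exact: (student_half R n).2.
(* a bounded interval already carries enough mass *)
have [k Hk] : exists k : nat,
    ((2^-1 - a)%:E < \int[@lebesgue_measure R]_(x in `]0%R, k%:R]) (f x)%:E)%E.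
  apply: contrapT => /forallNP H.
  have cv : (\int[@lebesgue_measure R]_(x in `]0%R, k%:R]) (f x)%:E)%E @[k --> \oo]
      --> (2^-1)%:E.
    rewrite -If (_ : `]0%R, +oo[%classic = \bigcup_k `]0%R, k%:R]%classic).
      apply: ge0_nondecreasing_set_cvg_integral => //.
        move=> i j ij; apply/subsetPset => x /=; rewrite !in_itv/= => /andP[-> /=].
        by move=> /le_trans; apply; rewrite ler_nat.
      by move=> i; exact: mf.
    apply/seteqP; split=> x /=; rewrite in_itv/= ?andbT.
      move=> x0; exists (Num.truncn x).+1 => //=.
      by rewrite in_itv/= x0/= ltW// truncnS_gt.
    by move=> [i _] /=; rewrite in_itv/= => /andP[].
  have : ((2^-1)%:E <= (2^-1 - a)%:E)%E.
    rewrite -(cvg_lim _ cv)//; apply: lime_le; first by apply/cvg_ex; eexists; exact: cv.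
    by apply: nearW => k; rewrite leNgt; exact/negP.
  by rewrite lee_fin; apply/negP; rewrite -ltNge; lra.
pose b : R := k%:R; have b0 : 0 <= b by exact: ler0n.
pose Phi x := parameterized_integral lebesgue_measure 0 x f.
have fin0 (D : set R) : measurable D -> D `<=` `[0, +oo[%classic ->
    (\int[lebesgue_measure]_(x in D) (f x)%:E)%E \is a fin_num.
  move=> mD DS; rewrite ge0_fin_numE; last by apply: integral_ge0 => x _.
  apply: (@le_lt_trans _ _ (2^-1 : R)%:E); last exact: ltry.
  rewrite -If integral_itv_obnd_cbnd; last exact: mf.
  by apply: ge0_subset_integral => //; exact: mf.
have PhiE x : 0 <= x ->
    (\int[@lebesgue_measure R]_(y in `]0%R, x]) (f y)%:E = (Phi x)%:E)%E.
  move=> x0; rewrite integral_itv_obnd_cbnd; last exact: mf.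
  rewrite /Phi /parameterized_integral /Rintegral.
  by rewrite fineK// fin0// => y /=; rewrite !in_itv/= andbT => /andP[].
have Phi0 : Phi 0 = 0.
  by rewrite /Phi /parameterized_integral set_itv1 Rintegral_set1.
have cPhi : {within `[0, b], continuous Phi}.
  apply: parameterized_integral_continuous => //.
  apply/integrableP; split; first exact: mf.
  under eq_integral do rewrite /= ger0_norm ?ltW ?student_pdf_gt0//.
  rewrite -ge0_fin_numE; last by apply: integral_ge0 => x _.
  by rewrite fin0// => y /=; rewrite !in_itv/= andbT => /andP[].
have vb : 2^-1 - a < Phi b by rewrite -lte_fin -PhiE.
have v0 : 0 <= 2^-1 - a by lra.
have [|c] := IVT b0 cPhi (v := 2^-1 - a).
  by rewrite Phi0 ge_min v0/= le_max (ltW vb) orbT.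
rewrite in_itv/= => /andP[c0 _] Phic; exists c => /=.
rewrite student_cdf_ge0E// PhiE// Phic -EFinD; congr EFin; lra.
Qed.

(** * Monotonicity of the length *)

Lemma student_E_gt0 (R : realType) (n : nat) : 0 < student_E R n.+2.
Proof.
by rewrite divr_gt0 ?mulr_gt0 ?Gamma_half_gt0// sqrtr_gt0 mulr_gt0.
Qed.

(** After multiplication by [student_E], the variable with one more degree of
    freedom has the larger density at 0, and the two densities cross exactly
    once on the positive half-line. *)
Lemma student_rescaled_cdf_lt (R : realType) (n : nat) (t : R) : 0 < t ->
  (student_cdf n.+1 t <
   student_cdf n.+2 (student_E R n.+2 / student_E R n.+3 * t))%E.
Proof.
set r := _ / _ => t0; have r0 : 0 < r by rewrite divr_gt0 ?student_E_gt0.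
have pi0 := pi_gt0 R.
rewrite (student_cdf_ge0E _ (ltW t0)) (student_cdf_ge0E _ (ltW (mulr_gt0 r0 t0))).
rewrite lteD2lE//.
pose f := @student_pdf R n.+1; pose g (x : R) := r * student_pdf n.+2 (r * x).
have f0 x : 0 < f x by exact: student_pdf_gt0.
have g0 x : 0 < g x by rewrite mulr_gt0 ?student_pdf_gt0.
have mf : measurable_fun setT f by exact: measurable_student_pdf.
have mr : measurable_fun setT (fun x : R => student_pdf n.+2 (r * x)).
  have mc : measurable_fun setT ( *%R r : R -> R) by exact: (@measurable_funM _ R).
  exact: (measurableT_comp (@measurable_student_pdf R n.+2 setT) mc).
have mg : measurable_fun setT g by exact: measurable_funM.
have Ig (D : set R) : measurable D ->
    (\int[lebesgue_measure]_(x in D) (student_pdf n.+2 x)%:E =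
     \int[lebesgue_measure]_(x in *%R r @^-1` D) (g x)%:E)%E.
  move=> mD; rewrite (ge0_integral_scale r0)//; last 2 first.
  - by apply/measurable_EFinP; exact: measurable_student_pdf.
  - by move=> x _; rewrite lee_fin ltW// student_pdf_gt0.
  rewrite -ge0_integralZl//.
  - rewrite -[X in measurable X]setTI.
    exact: (@measurable_funM _ R).
  - by apply/measurable_EFinP; exact: measurable_funTS.
  - by move=> x _; rewrite lee_fin ltW// student_pdf_gt0.
  - by rewrite lee_fin ltW.
rewrite Ig// (_ : *%R r @^-1` `]0, (r * t)] = `]0, t]%classic); last first.
  by apply/seteqP; split=> x /=; rewrite !in_itv/= ler_pM2l// pmulr_rgt0.
apply: (@single_crossing_integral R f g 2^-1) => //; try by move=> x; exact: ltW.
- exact: (student_half R n).2.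
- rewrite -(student_half R n.+1).2 Ig//; congr (integral _ _ _).
  by apply/seteqP; split=> x /=; rewrite !in_itv/= !andbT pmulr_rgt0.
move=> x y x0 xy.
pose d : R := n.+1%:R; pose d1 : R := n.+2%:R; pose d2 : R := n.+3%:R.
pose K := Gamma (d1 / 2) / (Num.sqrt (d * pi) * Gamma (d / 2)).
pose L := r * (Gamma (d2 / 2) / (Num.sqrt (d1 * pi) * Gamma (d1 / 2))).
have d0 : 0 < d by rewrite ltr0n.
have d10 : 0 < d1 by rewrite ltr0n.
have d20 : 0 < d2 by rewrite ltr0n.
have G0 : 0 < Gamma (d / 2) by exact: Gamma_half_gt0.
have G1 : 0 < Gamma (d1 / 2) by exact: Gamma_half_gt0.
have G2 : 0 < Gamma (d2 / 2) by exact: Gamma_half_gt0.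
have sq0 (z : R) : 0 < z -> 0 < Num.sqrt z by rewrite sqrtr_gt0.
have K0 : 0 < K.
  exact: (divr_gt0 G1 (mulr_gt0 (sq0 _ (mulr_gt0 d0 pi0)) G0)).
(* the peak grows by the factor sqrt ((n + 3) / (n + 2)); the Gamma factors
   cancel *)
have LE : L = K * (Num.sqrt d2 / Num.sqrt d1).
  rewrite /L /K /r /student_E /= -/d -/d1 -/d2 (sqrtrM d (ltW d10)).
  rewrite (sqrtrM d1 (ltW d20)) (sqrtrM pi (ltW d0)) (sqrtrM pi (ltW d10)).
  move: (sq0 _ d0) (sq0 _ d10) (sq0 _ d20) (sq0 _ pi0) G0 G1 G2.
  move: (Num.sqrt d) (Num.sqrt d1) (Num.sqrt d2) (Num.sqrt pi).
  move: (Gamma (d / 2)) (Gamma (d1 / 2)) (Gamma (d2 / 2)).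
  move=> h h1 h2 e e1 e2 p e0 e10 e20 p0 h0 h10 h20; field.
  by rewrite !gt_eqF.
have KL : K < L.
  by rewrite LE ltr_pMr// ltr_pdivlMr ?sqrtr_gt0// mul1r ltr_sqrt// ltr_nat.
have fE z : f z = K * (1 + d^-1 * z ^+ 2) `^ (- (d1 / 2)).
  by rewrite /f /student_pdf -/d -/d1 -/K [z ^+ 2 / d]mulrC.
have gE z : g z = L * (1 + r ^+ 2 / d1 * z ^+ 2) `^ (- (d2 / 2)).
  rewrite /g /student_pdf -/d1 -/d2 mulrA -/L exprMn.
  by congr (_ * (1 + _) `^ _); exact: mulrAC.
rewrite !fE !gE; apply: student_profile_crossing => //.
- by rewrite invr_ge0 ltW.
- by rewrite divr_ge0 ?sqr_ge0// ltW.
- by rewrite divr_gt0.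
- by rewrite ler_pM2r// ler_nat.
- exact: sqr_ge0.
- by rewrite ltr_pXn2r// ?nnegrE ltW// (lt_trans x0).
Qed.

(** The rescaled distribution function is larger, so the rescaled quantile is
    smaller; and the length is proportional to the quantile times [student_E]. *)
Lemma student_L_decreasing (R : realType) (sigma alpha : R) (n : nat) :
  0 < sigma -> 0 < alpha < 1 ->
  student_L sigma alpha n.+3 < student_L sigma alpha n.+2.
Proof.
move=> sigma0 /andP[a0 a1].
have ah : 0 < alpha / 2 <= 2^-1 by rewrite divr_gt0//=; lra.
have c0 : 0 < 2 * Num.sqrt 2 * sigma.
  by apply: mulr_gt0 => //; apply: mulr_gt0 => //; rewrite sqrtr_gt0.
rewrite /student_L -[X in X < _]mulrA -[X in _ < X]mulrA (ltr_pM2l c0) /=.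
set t := student_quantile n.+1 _; set t' := student_quantile n.+2 _.
have Et : student_cdf n.+1 t = (1 - alpha / 2)%:E by exact: student_quantile_cdf.
have Et' : student_cdf n.+2 t' = (1 - alpha / 2)%:E by exact: student_quantile_cdf.
(* the upper tail alpha / 2 is below 1 / 2, so the quantile is positive *)
have t0 : 0 < t.
  rewrite ltNge; apply/negP => /(student_cdf_homo n).
  by rewrite student_cdf0 Et lee_fin; apply/negP; rewrite -ltNge; lra.
have := student_rescaled_cdf_lt n t0; rewrite /= Et -Et'.
set r := _ / _ => lt_cdf.
have : t' < r * t.
  rewrite ltNge; apply/negP => /(student_cdf_homo n.+1).
  by rewrite leNgt lt_cdf.
by rewrite /r mulrAC ltr_pdivlMr ?student_E_gt0// [_ * t]mulrC.
Qed.

Theorem mainTheorem3 (R : realType) (mu sigma alpha : R)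
  (sigma_gt0 : 0 < sigma) (alpha_gt0 : 0 < alpha) (alpha_lt1 : alpha < 1) :
  (forall n : nat, (2 <= n)%N ->
    forall (d : measure_display) (T : measurableType d) (P : probability T R)
      (X : 'I_n -> {RV P >-> R}),
      iid_normal mu sigma X ->
      'E_P[(fun w : T => student_ci_length alpha (fun i => X i w))]%E
        = (student_L sigma alpha n)%:E) /\
  (forall n : nat, (2 <= n)%N ->
    student_L sigma alpha n.+1 < student_L sigma alpha n).
Proof.
split=> [[|[|n]]// _ d T P X iidX|[|[|n]]// _].
  exact: expectation_ci_length iidX.
by apply: student_L_decreasing => //; apply/andP.
Qed.
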